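(* Let $\Gamma=(V,E,s,r)$ be a finite directed graph. Then the center $Z(CK(\Gamma))$ of the Cuntz-Krieger $C^*$-algebra $CK(\Gamma)$ is the closure (in the norm topology of $CK(\Gamma)$) of the center $Z(L(\Gamma))$ of the Leavitt path algebra $L(\Gamma)$, where $L(\Gamma)$ is identified with its image in $CK(\Gamma)$.
   Context: A directed graph $\Gamma=(V,E,s,r)$ consists of a set $V$ of vertices, a set $E$ of edges, and maps $s,r:E\to V$ (source and range). It is finite if $V$ and $E$ are finite. $CK(\Gamma)$ is the universal $C^*$-algebra generated by $V\cup E$, where the elements of $V$ are mutually orthogonal projections, subject to: (1) $s(e)e=er(e)=e$ for all $e\in E$; (2) $e^*f=\delta_{e,f}r(f)$ for all $e,f\in E$; (3) $v=\sum_{e\in s^{-1}(v)}ee^*$ whenever $s^{-1}(v)\neq\emptyset$. The (non-closed) $\mathbb{C}$-subalgebra of $CK(\Gamma)$ generated by $V$, $E$, $E^*=\{e^*\mid e\in E\}$ is isomorphic to the Leavitt path algebra $L(\Gamma)$ over $\mathbb{C}$, and $L(\Gamma)$ is identified with this dense subalgebra. *)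

(* Defs.v *)
From HB Require Import structures.
From mathcomp Require Import all_boot all_order all_algebra.
From mathcomp Require Import all_classical all_reals all_analysis complex.

Set Implicit Arguments.
Unset Strict Implicit.
Unset Printing Implicit Defensive.

Import Order.TTheory GRing.Theory Num.Theory.
Import numFieldNormedType.Exports.

Local Open Scope classical_set_scope.
Local Open Scope complex_scope.
Local Open Scope ring_scope.

(* C*-algebras need not have a unit, so the product cannot be the one of a
   MathComp [pzRingType] and is given here, over a Banach space on [R[i]]. *)
HB.mixin Record isCstarAlgebra (R : realType) (A : Type)
    of CompleteNormedModule R[i] A := {
  cstar_mul : A -> A -> A;
  cstar_adj : A -> A;
  cstar_mulA : associative cstar_mul;
  cstar_mulDl : left_distributive cstar_mul +%R;
  cstar_mulDr : right_distributive cstar_mul +%R;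
  cstar_mulZl : forall (a : R[i]) (x y : A), cstar_mul (a *: x) y = a *: cstar_mul x y;
  cstar_mulZr : forall (a : R[i]) (x y : A), cstar_mul x (a *: y) = a *: cstar_mul x y;
  cstar_adjK : involutive cstar_adj;
  cstar_adjD : {morph cstar_adj : x y / x + y};
  cstar_adjZ : forall (a : R[i]) (x : A), cstar_adj (a *: x) = (a^*)%R *: cstar_adj x;
  cstar_adjM : forall x y,
    cstar_adj (cstar_mul x y) = cstar_mul (cstar_adj y) (cstar_adj x);
  cstar_normM : forall x y, `|cstar_mul x y| <= `|x| * `|y| :> R[i];
  cstar_normE : forall x, `|cstar_mul (cstar_adj x) x| = `|x| ^+ 2 :> R[i]
}.

#[short(type="cstarAlgType")]
HB.structure Definition CstarAlgebra (R : realType) :=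
  {A of CompleteNormedModule R[i] A & isCstarAlgebra R A}.

Declare Scope cstar_scope.
Delimit Scope cstar_scope with cstar.
Notation "x * y" := (cstar_mul x y) : cstar_scope.
Notation "x ^*" := (cstar_adj x) : cstar_scope.
Local Open Scope cstar_scope.

Definition star_hom (R : realType) (A B : cstarAlgType R) (f : A -> B) : Prop :=
  [/\ linear f,
      (forall x y, f (x * y) = f x * f y)
    & (forall x, f x^* = (f x)^*)].

Definition subalgebra (R : realType) (A : cstarAlgType R) (S : set A) : Prop :=
  [/\ S 0,
      (forall (a : R[i]) x y, S x -> S y -> S (a *: x + y))
    & (forall x y, S x -> S y -> S (x * y))].

Definition cstar_subalgebra (R : realType) (A : cstarAlgType R) (S : set A) :
    Prop :=
  [/\ subalgebra S, (forall x, S x -> S x^*) & closed S].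

Definition alg_center (R : realType) (A : cstarAlgType R) (S : set A) : set A :=
  [set z | S z /\ forall x, S x -> z * x = x * z].

Record finDigraph := FinDigraph {
  vertex : finType;
  edge : finType;
  source : edge -> vertex;
  range_of : edge -> vertex
}.
Arguments source {f}.
Arguments range_of {f}.

Record ck_family (R : realType) (G : finDigraph) (A : cstarAlgType R)
    (p : vertex G -> A) (t : edge G -> A) : Prop := CkFamily {
  ck_adj : forall v, (p v)^* = p v;
  ck_idem : forall v, p v * p v = p v;
  ck_orth : forall v w, v <> w -> p v * p w = 0;
  ck_source : forall e, p (source e) * t e = t e;
  ck_range : forall e, t e * p (range_of e) = t e;
  ck_edge : forall e f, (t e)^* * t f = if e == f then p (range_of e) else 0;
  ck_sum : forall v, (exists e, source e = v) ->
    p v = \sum_(e | source e == v) (t e * (t e)^*)%cstar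
}.

(* [A], with generators [p] and [t], is the universal C*-algebra CK(G). It is
   specified only up to isomorphism, and uniqueness of [f] follows from
   [ck_generated]. *)
Record is_CK (R : realType) (G : finDigraph) (A : cstarAlgType R)
    (p : vertex G -> A) (t : edge G -> A) : Prop := IsCK {
  ck_relations : ck_family p t;
  ck_generated :
    smallest (@cstar_subalgebra R A) (range p `|` range t) = setT;
  ck_universal : forall (B : cstarAlgType R)
      (q : vertex G -> B) (u : edge G -> B), ck_family q u ->
    exists f : A -> B,
      [/\ star_hom f, (forall v, f (p v) = q v) & (forall e, f (t e) = u e)]
}.

(* The Leavitt path algebra of G, identified with its image in CK(G). *)
Definition leavitt (R : realType) (G : finDigraph) (A : cstarAlgType R)
    (p : vertex G -> A) (t : edge G -> A) : set A :=
  smallest (@subalgebra R A)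
    (range p `|` range t `|` range (fun e => (t e)^*)).

(* Main.v *)
Require Import Defs.
From mathcomp Require Import all_boot all_order all_algebra.
From mathcomp Require Import all_classical all_reals all_analysis complex.
From mathcomp Require Import cyclic separable cyclotomic.
From mathcomp Require Import ring lra zify.

(** A commutator is continuous in each argument and the Leavitt algebra L is
    dense, so the closure of its center consists of central elements. For the
    converse a central z is approximated by central elements of L.

    By universality the circle acts on A by automorphisms fixing every p v and
    multiplying every t e by the same scalar (gauge_exists). They are
    contractive (star_hom_contractive) and preserve the center. The elements of
    L are combinations of monomials, the word al times a vertex projection
    times the adjoint of the word be (leavitt_mspan), and the gauge action
    scales such a monomial by a character of the circle which depends on its
    degree, the difference of the lengths of al and be. So z has homogeneous
    components, its Fourier coefficients along this action; they are central
    (component_central), and the Cesaro means of the Fourier series of z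
    converge to z in norm, as in the theorem of Fejer (fejer_approx). In place
    of integrals over the circle, averages over the M-th roots of unity are
    used, followed by a limit in M.

    It remains to see that a central element z of nonnegative degree n in the
    closed homogeneous sense belongs to L (central_hom_leavitt); negative
    degrees follow by taking adjoints. For a path U with range w one has z p(w)
    = adj U z U. When U is long enough, compressing in this way turns every
    monomial of degree n into a combination of words of length n; so if w ends
    arbitrarily long paths, z p(w) is a limit of elements of the finite
    dimensional space spanned by the words of length n times p(w), and
    therefore lies in it (corner_leavitt). The same holds when w is a sink.
    From these vertices the property z p(v) in L spreads to all others: if v is
    not a sink, the relation p(v) = sum of t(e) adj (t(e)) over the edges
    leaving v gives z p(v) = sum of t(e) z p(range e) adj (t(e)). A vertex to
    which it did not spread would start arbitrarily long paths through
    exceptional vertices, and as the graph is finite one of these would end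
    arbitrarily long paths. *)

Set Implicit Arguments.
Unset Strict Implicit.
Unset Printing Implicit Defensive.

Import Order.TTheory GRing.Theory Num.Theory.
Import numFieldNormedType.Exports.

Local Open Scope classical_set_scope.
Local Open Scope ring_scope.

Local Notation "x ** y" := (cstar_mul x y) (at level 40, left associativity).
Local Notation adj := cstar_adj.

(** * Real-valued norms and limits of sequences *)

Section RealNorm.
Context {R : realType}.

(** Norms take values in R[i], whose order is only partial; their real parts
    carry the same information and live in an ordered field. *)
Definition rnorm (V : normedZmodType R[i]) (x : V) : R := complex.Re `|x|.

Section Zmod.
Variable V : normedZmodType R[i].
Implicit Types x y : V.

Lemma normE x : `|x| = (rnorm x)%:C%C.
Proof. by rewrite /rnorm RRe_real // normr_real. Qed.

Lemma rnorm_ge0 x : 0 <= rnorm x.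
Proof. by rewrite -ler0c -normE. Qed.

Lemma rnormD x y : rnorm (x + y) <= rnorm x + rnorm y.
Proof. by rewrite -lecR rmorphD /= -!normE ler_normD. Qed.

Lemma rnorm0 : rnorm (0 : V) = 0.
Proof. by rewrite /rnorm normr0. Qed.

Lemma rnormN x : rnorm (- x) = rnorm x.
Proof. by rewrite /rnorm normrN. Qed.

Lemma rdistC x y : rnorm (x - y) = rnorm (y - x).
Proof. by rewrite -rnormN opprB. Qed.

Lemma rnorm_eq0 x : rnorm x = 0 -> x = 0.
Proof. by move=> x0; apply/normr0_eq0; rewrite normE x0. Qed.

Lemma rnorm_sum I (r : seq I) (P : pred I) (F : I -> V) :
  rnorm (\sum_(i <- r | P i) F i) <= \sum_(i <- r | P i) rnorm (F i).
Proof.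
elim/big_ind2: _ => [|x a y b xa yb|//]; first by rewrite rnorm0.
exact: le_trans (rnormD _ _) (lerD xa yb).
Qed.

Lemma rdistD z x y : rnorm (x - y) <= rnorm (x - z) + rnorm (z - y).
Proof. by apply: le_trans (rnormD _ _); rewrite addrA subrK. Qed.

Lemma rnorm_small x : (forall e, 0 < e -> rnorm x < e) -> x = 0.
Proof.
move=> small; apply: rnorm_eq0; apply: le_anti; rewrite rnorm_ge0 andbT.
by rewrite leNgt; apply/negP => /small; rewrite ltxx.
Qed.
End Zmod.

Lemma rnormC (c : R) : rnorm (c%:C%C : R[i]) = `|c|.
Proof. by rewrite /rnorm normc_def /= expr0n addr0 sqrtr_sqr. Qed.

Lemma rnorm1 : rnorm (1 : R[i]) = 1.
Proof. by rewrite /rnorm normr1. Qed.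

Lemma rnormZ (V : normedModType R[i]) a (x : V) :
  rnorm (a *: x) = rnorm a * rnorm x.
Proof. by apply: complexI; rewrite rmorphM /= -!normE normrZ. Qed.

Lemma rnormcM (a b : R[i]) : rnorm (a * b) = rnorm a * rnorm b.
Proof. by apply: complexI; rewrite rmorphM /= -!normE normrM. Qed.

Lemma rnorm_conj (a : R[i]) : rnorm a^* = rnorm a.
Proof. by rewrite /rnorm norm_conjC. Qed.

Lemma rnormX (a : R[i]) n : rnorm (a ^+ n) = rnorm a ^+ n.
Proof. by elim: n => [|n IH]; rewrite ?rnorm1 // !exprS rnormcM IH. Qed.

Lemma rnorm_natV n : rnorm (n.+1%:R^-1 : R[i]) = n.+1%:R^-1.
Proof.
have -> : (n.+1%:R^-1 : R[i]) = (n.+1%:R^-1 : R)%:C%C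
  by rewrite fmorphV rmorph_nat.
by rewrite rnormC gtr0_norm // invr_gt0.
Qed.

Lemma rnorm_half : rnorm (2^-1 : R[i]) = 2^-1.
Proof. exact: (rnorm_natV 1). Qed.

Lemma rnorm_ReIm (a : R[i]) : [/\ `|complex.Re a| <= rnorm a,
  `|complex.Im a| <= rnorm a & rnorm a <= `|complex.Re a| + `|complex.Im a|].
Proof.
have -> : rnorm a = Num.sqrt (complex.Re a ^+ 2 + complex.Im a ^+ 2).
  by rewrite /rnorm normc_def.
split.
- by rewrite -sqrtr_sqr ler_sqrt ?lerDl ?addr_ge0 ?sqr_ge0.
- by rewrite -sqrtr_sqr ler_sqrt ?lerDr ?addr_ge0 ?sqr_ge0.
rewrite -[leRHS]ger0_norm ?addr_ge0 // -sqrtr_sqr ler_sqrt ?sqr_ge0 //.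
rewrite sqrrD !real_normK ?num_real // addrAC lerDl.
by rewrite mulrn_wge0 // mulr_ge0.
Qed.

Lemma closure_rnorm (V : normedModType R[i]) (S : set V) x :
  closure S x <-> forall e : R, 0 < e -> exists2 y, S y & rnorm (x - y) < e.
Proof.
split=> [clx e e0 | Sx B /nbhs_ballP[e /= e0 Be]].
  have /clx[y [Sy]] : nbhs x (ball x e%:C%C).
    by apply: nbhsx_ballx; rewrite ltcR.
  rewrite -ball_normE /= normE ltcR => xy; by exists y.
have e0' : 0 < complex.Re e by move: e0; rewrite ltcE => /andP[].
have eE : e = (complex.Re e)%:C%C by rewrite RRe_real // ger0_real // ltW.
have [y Sy xy] := Sx _ e0'; exists y; split=> //; apply: Be.
by rewrite -ball_normE /= normE eE ltcR.
Qed.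

Definition rcvg (V : normedZmodType R[i]) (u : nat -> V) (l : V) :=
  forall e : R, 0 < e -> exists N, forall n, (N <= n)%N -> rnorm (u n - l) < e.

Definition rcauchy (V : normedZmodType R[i]) (u : nat -> V) :=
  forall e : R, 0 < e ->
    exists N, forall m n, (N <= m)%N -> (N <= n)%N -> rnorm (u m - u n) < e.

Lemma rcauchy_cvg (V : completeNormedModType R[i]) (u : nat -> V) :
  rcauchy u -> exists l, rcvg u l.
Proof.
move=> uC; have /cvg_ex[l ul] : cvg (u @ \oo).
  apply/cauchy_cvgP; apply/cauchy_ballP => e e0.
  have e0' : 0 < complex.Re e by move: e0; rewrite ltcE => /andP[].
  have eE : e = (complex.Re e)%:C%C by rewrite RRe_real // ger0_real // ltW.
  have [N uN] := uC _ e0'.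
  near_simpl; exists ([set n | N <= n], [set n | N <= n])%N; first by split;
    exists N.
  move=> [m n] [/= Nm Nn]; rewrite -ball_normE /= normE eE ltcR.
  exact: uN.
exists l => e e0; move/cvgrPdist_lt: ul => /(_ e%:C%C).
rewrite ltcR => /(_ e0)[N _ ulN]; exists N => n Nn.
by rewrite rdistC; have := ulN n Nn; rewrite /= normE ltcR.
Qed.

End RealNorm.

Section Limits.
Context {R : realType}.

Lemma rcvg_unique (V : normedZmodType R[i]) (u : nat -> V) l l' :
  rcvg u l -> rcvg u l' -> l = l'.
Proof.
move=> ul ul'; apply/eqP; rewrite -subr_eq0; apply/eqP/rnorm_small => e e0.
have e20 : 0 < e / 2 by lra.
have [[N uN] [N' uN']] := (ul _ e20, ul' _ e20).
have := uN (maxn N N') (leq_maxl _ _); have := uN' (maxn N N') (leq_maxr _ _).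
have := rdistD (u (maxn N N')) l l'; rewrite (rdistC l (u _)); lra.
Qed.

(** Lipschitz control of one sequence by another; it replaces continuity
    arguments for the algebra operations. *)
Lemma rcvg_dom (V W : normedZmodType R[i]) (u : nat -> V) (v : nat -> W) l m C :
  (forall n, rnorm (v n - m) <= C * rnorm (u n - l)) -> rcvg u l -> rcvg v m.
Proof.
move=> vu ul e e0; have C0 : 0 < `|C| + 1 by have := normr_ge0 C; lra.
have [N uN] := ul (e / (`|C| + 1)) (divr_gt0 e0 C0).
exists N => n /uN; rewrite ltr_pdivlMr // => lt; apply: le_lt_trans (vu n) _.
apply: le_lt_trans lt; rewrite mulrC; apply: (ler_wpM2l (rnorm_ge0 _)).
by have := ler_norm C; lra.
Qed.

Lemma rcvg_bound (V : normedZmodType R[i]) (u : nat -> V) l C :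
  (forall n, rnorm (u n) <= C) -> rcvg u l -> rnorm l <= C.
Proof.
move=> uC ul; apply/ler_addgt0Pr => e /ul[N /(_ N (leqnn _))].
have := rdistD 0 l (u N); have := uC N; rewrite rdistC => + + .
have := rdistD (u N) l 0; rewrite !subr0 rdistC; lra.
Qed.

Lemma rcvg_sum (V : normedZmodType R[i]) I (r : seq I) (u : I -> nat -> V)
    (l : I -> V) :
  (forall i, rcvg (u i) (l i)) ->
  rcvg (fun n => \sum_(i <- r) u i n) (\sum_(i <- r) l i).
Proof.
move=> ul; elim: r => [|i r IH].
  by move=> e e0; exists 0 => n _; rewrite !big_nil subr0 rnorm0.
move=> e e0; have e20 : 0 < e / 2 by lra.
have [[N uN] [N' uN']] := (ul i _ e20, IH _ e20).
exists (maxn N N') => n; rewrite geq_max => /andP[/uN h /uN' h'].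
rewrite !big_cons opprD addrACA; apply: le_lt_trans (rnormD _ _) _; lra.
Qed.

(** The tail of the telescoping sum is dominated by a geometric series. *)
Lemma geometric_rcauchy (V : normedZmodType R[i]) (u : nat -> V) (q C : R) :
  0 <= q < 1 -> (forall n, rnorm (u n.+1 - u n) <= C * q ^+ n) -> rcauchy u.
Proof.
move=> /andP[q0 q1] uq e e0.
have C0 : 0 <= C by have := uq 0; rewrite expr0 mulr1;
  apply: le_trans (rnorm_ge0 _).
have q1' : 0 < 1 - q by lra.
have tail n d :
    rnorm (u (n + d)%N - u n) <= C * q ^+ n / (1 - q) * (1 - q ^+ d).
  elim: d => [|d IH]; first by rewrite addn0 !subrr rnorm0 mulr0.
  have := rdistD (u (n + d)%N) (u (n + d).+1) (u n); rewrite addnS.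
  move/le_trans; apply; have := uq (n + d)%N; rewrite exprD => step.
  apply: le_trans (lerD step IH) _.
  rewrite le_eqVlt; apply/orP; left; apply/eqP; rewrite exprS.
  by field; rewrite gt_eqF.
have D0 : 0 < 2 * C / (1 - q) + 1.
  by apply: ltr_wpDl => //; apply: divr_ge0; [lra|exact: ltW].
have [N qN] : exists N, forall n, (N <= n)%N ->
  q ^+ n < e / (2 * C / (1 - q) + 1).
  have /cvg_expr/cvgrPdist_lt/(_ _ (divr_gt0 e0 D0)) :
    `|q| < 1 by rewrite ger0_norm.
  move=> [N _ qN]; exists N => n /qN /=.
  by rewrite sub0r normrN ger0_norm // exprn_ge0.
have tailN n : (N <= n)%N -> rnorm (u n - u N) <= C / (1 - q) * q ^+ N.
  move=> /subnKC <-; apply: le_trans (tail _ _) _.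
  have -> : C * q ^+ N / (1 - q) = C / (1 - q) * q ^+ N by ring.
  rewrite ler_piMr //; last by have := exprn_ge0 (n - N) q0; lra.
  by rewrite mulr_ge0 ?exprn_ge0 // divr_ge0 // ltW.
exists N => m n Nm Nn; have := rdistD (u N) (u m) (u n); rewrite (rdistC (u N)).
have := tailN _ Nm; have := tailN _ Nn; have := qN _ (leqnn N).
rewrite ltr_pdivlMr // => h; have := exprn_ge0 N q0; move: h.
have -> : 2 * C / (1 - q) = C / (1 - q) *+ 2 by rewrite mulr2n; ring.
rewrite mulr2n; set D := C / (1 - q); set Q := q ^+ N; nra.
Qed.
End Limits.

(** * Contractivity of star homomorphisms *)

Section Cstar.
Context {R : realType}.

Section Algebra.
Variable A : cstarAlgType R.
Implicit Types x y z : A.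

Lemma mul0c x : 0 ** x = 0.
Proof. by rewrite -[0 in LHS](scale0r (0 : A)) cstar_mulZl scale0r. Qed.

Lemma mulc0 x : x ** 0 = 0.
Proof. by rewrite -[0 in LHS](scale0r (0 : A)) cstar_mulZr scale0r. Qed.

Lemma mulNc x y : - x ** y = - (x ** y).
Proof. by rewrite -scaleN1r cstar_mulZl scaleN1r. Qed.

Lemma mulcN x y : x ** - y = - (x ** y).
Proof. by rewrite -scaleN1r cstar_mulZr scaleN1r. Qed.

Lemma mulcBl x y z : (x - y) ** z = x ** z - y ** z.
Proof. by rewrite cstar_mulDl mulNc. Qed.

Lemma mulcBr x y z : z ** (x - y) = z ** x - z ** y.
Proof. by rewrite cstar_mulDr mulcN. Qed.

Lemma mulc_suml I (r : seq I) (P : pred I) (F : I -> A) x :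
  (\sum_(i <- r | P i) F i) ** x = \sum_(i <- r | P i) F i ** x.
Proof. by apply: (big_morph (fun y => y ** x)) => [y z|];
  rewrite ?cstar_mulDl ?mul0c. Qed.

Lemma mulc_sumr I (r : seq I) (P : pred I) (F : I -> A) x :
  x ** (\sum_(i <- r | P i) F i) = \sum_(i <- r | P i) x ** F i.
Proof. by apply: (big_morph (fun y => x ** y)) => [y z|];
  rewrite ?cstar_mulDr ?mulc0. Qed.

Lemma adj0 : adj (0 : A) = 0.
Proof. by rewrite -[0 in LHS](scale0r (0 : A)) cstar_adjZ rmorph0 scale0r. Qed.

Lemma adjN x : adj (- x) = - adj x.
Proof. by rewrite -scaleN1r cstar_adjZ rmorphN1 scaleN1r. Qed.

Lemma adjB x y : adj (x - y) = adj x - adj y.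
Proof. by rewrite cstar_adjD adjN. Qed.

Lemma adj_sum I (r : seq I) (P : pred I) (F : I -> A) :
  adj (\sum_(i <- r | P i) F i) = \sum_(i <- r | P i) adj (F i).
Proof. exact: (big_morph _ (@cstar_adjD _ _) adj0). Qed.

Lemma rnormM x y : rnorm (x ** y) <= rnorm x * rnorm y.
Proof. by have := cstar_normM x y; rewrite !normE -rmorphM lecR. Qed.

Lemma rnormE x : rnorm (adj x ** x) = rnorm x ^+ 2.
Proof. by have := cstar_normE x; rewrite !normE -rmorphXn => -[]. Qed.

Lemma rnorm_adj x : rnorm (adj x) = rnorm x.
Proof.
have le y : rnorm y <= rnorm (adj y).
  have [->|y0] := eqVneq y 0; first by rewrite adj0.
  have ny : 0 < rnorm y.
    by rewrite lt_neqAle rnorm_ge0 andbT eq_sym;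
      apply: contraNneq y0 => /rnorm_eq0 ->.
  by rewrite -(ler_pM2r ny) -expr2 -rnormE rnormM.
by apply: le_anti; rewrite le -{2}(cstar_adjK x) le.
Qed.

Definition is_unit e := forall x, e ** x = x /\ x ** e = x.

Lemma unit_adj e : is_unit e -> adj e = e.
Proof.
move=> e1; have [_ h] := e1 (adj e); rewrite -{1}h.
by rewrite -{2}(cstar_adjK e) -cstar_adjM h cstar_adjK.
Qed.

(** By the C*-identity |e| = |e|^2. *)
Lemma unit_rnorm e : is_unit e -> rnorm e <= 1.
Proof.
move=> e1; have := rnormE e; rewrite unit_adj // (e1 e).1 => ee.
by have := rnorm_ge0 e; nra.
Qed.

Lemma sqr_dist x y :
  rnorm (x ** x - y ** y) <= (rnorm x + rnorm y) * rnorm (x - y).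
Proof.
have -> : x ** x - y ** y = x ** (x - y) + (x - y) ** y.
  by rewrite mulcBr mulcBl addrA subrK.
apply: le_trans (rnormD _ _) _; rewrite mulrDl.
by apply: lerD (rnormM _ _) _; rewrite mulrC rnormM.
Qed.

(** The map w |-> (a + w^2) / 2 preserves the ball of radius |a| and contracts
    it by the factor |a|; at its fixed point w, the square of 1 - w is 1 - a.
    Commutation with a and self-adjointness pass from the iterates to the
    limit. This provides square roots without any spectral theory. *)
Lemma sqrt_defect a : adj a = a -> rnorm a < 1 ->
  exists w, [/\ adj w = w, w + w = a + w ** w &
    forall x, x ** a = a ** x -> x ** w = w ** x].
Proof.
move=> aS a1; set q := rnorm a; have q0 : 0 <= q := rnorm_ge0 _.
pose F w := (2^-1 : R[i]) *: (a + w ** w); pose u n := iter n F 0.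
have F2 w : F w + F w = a + w ** w.
  by rewrite -scalerDl -[2^-1]div1r -splitr scale1r.
have uq n : rnorm (u n) <= q.
  elim: n => [|n IH]; rewrite /= ?rnorm0 // /F rnormZ rnorm_half.
  have := rnormD a (u n ** u n); have := rnormM (u n) (u n).
  have := rnorm_ge0 (u n); move: IH; rewrite -/(u n) -/q.
  by set r := rnorm (u n); set s := rnorm (_ ** _); set v := rnorm _; nra.
have step n : rnorm (u n.+2 - u n.+1) <= q * rnorm (u n.+1 - u n).
  rewrite /= -!/(u _) /F -scalerBr rnormZ rnorm_half opprD addrACA subrr add0r.
  have /le_trans := sqr_dist (u n.+1) (u n) => dist.
  rewrite -ler_pdivlMl ?invr_gt0 // invrK mulrA; apply: dist.
  apply: (ler_wpM2r (rnorm_ge0 _)); have := uq n; have := uq n.+1; lra.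
have [|w uw] := @rcauchy_cvg R A u.
  apply: (@geometric_rcauchy _ _ _ q q); first by rewrite q0.
  elim=> [|n IH]; first by rewrite /= subr0 expr0 mulr1 (uq 1).
  apply: le_trans (step n) _; rewrite exprS mulrCA.
  exact: ler_wpM2l.
have wq : rnorm w <= q := rcvg_bound uq uw.
exists w; split.
- apply: (rcvg_unique _ uw); apply: (rcvg_dom (C := 1)) uw => n.
  have {1}-> : u n = adj (u n).
    by elim: n => [|n IH]; rewrite /= ?adj0 // /F cstar_adjZ cstar_adjD
      cstar_adjM
      -!/(u n) -IH aS fmorphV rmorph_nat.
  by rewrite mul1r -adjB rnorm_adj.
- have uSw : rcvg (fun n => u n.+1) w.
    by move=> e /uw[N uN]; exists N => n Nn; exact: uN (leqW Nn).
  rewrite -F2; suff -> : F w = w by [].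
  apply: (rcvg_unique _ uSw); apply: (rcvg_dom (C := q)) uw => n.
  rewrite /= -/(u n) /F -scalerBr rnormZ rnorm_half opprD addrACA subrr add0r.
  rewrite -ler_pdivlMl ?invr_gt0 // invrK mulrA.
  apply: le_trans (sqr_dist _ _) _; apply: (ler_wpM2r (rnorm_ge0 _)).
  by have := uq n; lra.
- move=> x xa; apply/eqP; rewrite -subr_eq0; apply/eqP.
  apply: (@rcvg_unique _ _ (fun n => x ** u n - u n ** x)).
    apply: (rcvg_dom (C := rnorm x + rnorm x)) uw => n.
    have -> : x ** u n - u n ** x - (x ** w - w ** x) =
        x ** (u n - w) - (u n - w) ** x.
      rewrite mulcBl mulcBr !opprB addrACA [RHS]addrACA; congr (_ + _).
      exact: addrC.
    apply: le_trans (rnormD _ _) _; rewrite rnormN mulrDl.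
    by apply: lerD (rnormM _ _) _; rewrite mulrC rnormM.
  suff xu n : x ** u n = u n ** x.
    by move=> e e0; exists 0 => n _; rewrite xu subrr subr0 rnorm0.
  elim: n => [|n IH]; rewrite /= ?mulc0 ?mul0c // -/(u n) /F.
  rewrite cstar_mulZr cstar_mulZl cstar_mulDl cstar_mulDr xa.
  by rewrite cstar_mulA IH -cstar_mulA IH cstar_mulA.
Qed.
End Algebra.

(** Let y be self-adjoint with |y| < 1. Then 1 - y^2 = b^2 for some
    self-adjoint b commuting with y, so that f y + i f b is unitary, has norm
    at most 1, and f y is its real part. The general case follows by scaling
    and by the C*-identity. No continuity of f is assumed. *)
Lemma star_hom_contractive (A B : cstarAlgType R) (f : A -> B) (e : A) x :
  star_hom f -> is_unit e -> is_unit (f e) -> rnorm (f x) <= rnorm x.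
Proof.
move=> [flin fM fS] e1 fe1.
have f0 : f 0 = 0 by have := flin (-1) 0 0; rewrite scaler0 addr0 scaleN1r
  addNr.
have fD y z : f (y + z) = f y + f z by have := flin 1 y z; rewrite !scale1r.
have fZ a y : f (a *: y) = a *: f y by have := flin a y 0;
  rewrite !addr0 f0 addr0.
have fB y z : f (y - z) = f y - f z by rewrite fD -scaleN1r fZ scaleN1r.
have ball y : adj y = y -> rnorm y < 1 -> rnorm (f y) <= 1.
  move=> yS y1; have yy1 : rnorm (y ** y) < 1.
    have := rnormM y y; have := rnorm_ge0 y; nra.
  have [|w [wS ww wC]] := sqrt_defect _ yy1; first by rewrite cstar_adjM yS.
  have yw := wC y (cstar_mulA y y y).
  pose b := f (e - w); set Y := f y; have bS : adj b = b.
    by rewrite /b -fS adjB wS unit_adj.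
  have YS : adj Y = Y by rewrite /Y -fS yS.
  have Yb : Y ** b = b ** Y.
    by rewrite -!fM mulcBr mulcBl yw (e1 y).1 (e1 y).2.
  have YYbb : Y ** Y + b ** b = f e.
    rewrite -!fM -fD mulcBr !mulcBl (e1 e).1 (e1 w).1 (e1 w).2; congr f.
    have -> : e - w - (w - w ** w) = e - y ** y.
      have -> : w ** w = w + w - y ** y by rewrite ww addrAC subrr add0r.
      by rewrite -addrA opprB (addrAC (w + w)) addrK addKr.
    by rewrite addrC subrK.
  pose U := Y + 'i *: b; have adjU : adj U = Y - 'i *: b.
    by rewrite cstar_adjD YS cstar_adjZ bS conjCi scaleNr.
  have UU : adj U ** U = f e.
    rewrite adjU mulcBl !cstar_mulDr !cstar_mulZl !cstar_mulZr Yb scalerA.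
    by rewrite -expr2 sqrCi scaleN1r opprD opprK addrA addrK.
  have U1 : rnorm U <= 1.
    have := rnormE U; rewrite UU; have := unit_rnorm fe1; have := rnorm_ge0 U;
      nra.
  have -> : Y = (2^-1 : R[i]) *: (U + adj U).
    by rewrite adjU addrACA subrr addr0 scalerDr -scalerDl -[2^-1]div1r
      -splitr scale1r.
  rewrite rnormZ rnorm_half; have := rnormD U (adj U); rewrite rnorm_adj; lra.
(* y is divided by |y| + d to enter the open unit ball. *)
have self y : adj y = y -> rnorm (f y) <= rnorm y.
  move=> yS; apply/ler_addgt0Pr => d d0; have y0 := rnorm_ge0 y.
  have r0 : 0 < rnorm y + d by lra.
  have := ball ((rnorm y + d)^-1%:C%C *: y); rewrite fZ !rnormZ rnormC.
  rewrite ger0_norm ?invr_ge0 ?(ltW r0) // !ler_pdivrMl // mulr1; apply.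
    by rewrite cstar_adjZ yS conj_Creal // complex_real.
  by rewrite ltr_pdivrMl //; lra.
have := self (adj x ** x); rewrite fM fS !rnormE cstar_adjM cstar_adjK =>
  /(_ erefl).
have := rnorm_ge0 x; have := rnorm_ge0 (f x); nra.
Qed.
End Cstar.

(** * Averages over roots of unity *)

Section RootsOfUnity.
Context {R : realType}.

Lemma prim_root_exists n : exists w : R[i], n.+1.-primitive_root w.
Proof.
pose q : {poly R[i]} := 'X^(n.+1) - 1.
have q_mon : q \is monic by exact: monicXnsubC.
have [r qE] := closed_field_poly_normal q.
rewrite (monicP q_mon) scale1r in qE.
have r_root : all n.+1.-unity_root r.
  by apply/allP => z zr; rewrite /root_of_unity -/q qE root_prod_XsubC.
have size_r : (n.+1 < (size r).+1)%N.
  by rewrite -(size_prod_XsubC r id) -qE size_XnsubC.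
have [|w] := hasP (has_prim_root (ltn0Sn n) r_root _ size_r); last by exists w.
by rewrite -separable_prod_XsubC -qE separable_Xn_sub_1 // pnatr_eq0.
Qed.

Lemma prim_root_conj n (w : R[i]) : n.+1.-primitive_root w -> w * w^* = 1.
Proof.
move=> wP; have /eqP : `|w| ^+ n.+1 = 1 by rewrite -normrX (prim_expr_order
  wP) normr1.
rewrite pexprn_eq1 ?normr_ge0 //= => /eqP w1.
by rewrite -normCK w1 expr1n.
Qed.

Lemma unit_root_conj n (w : R[i]) k : n.+1.-primitive_root w ->
  w ^+ k * (w ^+ k)^* = 1.
Proof. by move=> /prim_root_conj w1; rewrite rmorphXn -exprMn w1 expr1n. Qed.

(** A geometric sum: its ratio z = w^a conj(w)^b satisfies z^(n+1) = 1, and is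
    1 exactly when a and b are congruent modulo n + 1. *)
Lemma sum_prim_root n (w : R[i]) a b : n.+1.-primitive_root w ->
  \sum_(k < n.+1) (w ^+ k) ^+ a * ((w ^+ k)^*) ^+ b =
  if a == b %[mod n.+1] then n.+1%:R else 0.
Proof.
move=> wP; have w1 := prim_root_conj wP; pose z := w ^+ a * w^* ^+ b.
have zw : z * w ^+ b = w ^+ a.
  by rewrite /z -mulrA -exprMn [w^* * w]mulrC w1 expr1n mulr1.
have zE : (z == 1) = (a == b %[mod n.+1]).
  rewrite -(eq_prim_root_expr wP); apply/eqP/eqP => [z1|ab].
    by rewrite -zw z1 mul1r.
  by rewrite /z ab -exprMn w1 expr1n.
have -> : \sum_(k < n.+1) (w ^+ k) ^+ a * ((w ^+ k)^*) ^+ b =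
  \sum_(k < n.+1) z ^+ k.
  apply: eq_bigr => k _; rewrite /z exprMn rmorphXn -!exprM.
  by rewrite [(k * a)%N]mulnC [(k * b)%N]mulnC.
rewrite -zE; case: eqVneq => [->|z1].
  by under eq_bigr do rewrite expr1n; rewrite sumr_const card_ord.
have : (z - 1) * \sum_(k < n.+1) z ^+ k = 0.
  rewrite -subrX1 /z exprMn -!exprM ![(_ * n.+1)%N]mulnC !exprM -rmorphXn.
  by rewrite (prim_expr_order wP) rmorph1 !expr1n mulr1 subrr.
by move/eqP; rewrite mulf_eq0 subr_eq0 (negbTE z1) => /eqP.
Qed.

(** The pairs (i, j) with a + j = b + i form a diagonal of the square of side N
    + 1, shifted by at most a + b; it is met in every row i except those with b
    + i < a or b + i > a + N. *)
Lemma sum_shift_diag (N a b : nat) :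
  (\sum_(i < N.+1) \sum_(j < N.+1) (a + j == b + i) <= N.+1)%N /\
  (N.+1 <= (\sum_(i < N.+1) \sum_(j < N.+1) (a + j == b + i)) + (a + b))%N.
Proof.
have inner i : (\sum_(j < N.+1) (a + j == b + i) = (a <= b + i <= a + N))%N.
  elim: N => [|N IH]; first by rewrite big_ord1 /=; lia.
  by rewrite big_ord_recr IH /=; lia.
under eq_bigr do rewrite inner.
have lo n : (\sum_(i < n) (i < a) = minn n a)%N.
  by elim: n => [|n IH]; rewrite ?big_ord0 ?big_ord_recr ?IH /=; lia.
have hi n : (\sum_(i < n) (a + N < b + i) = n - ((a + N).+1 - b))%N.
  by elim: n => [|n IH]; rewrite ?big_ord0 ?big_ord_recr ?IH /=; lia.
have tot : (\sum_(i < N.+1) 1 = N.+1)%N by rewrite sum_nat_const card_ord muln1.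
split; first by rewrite -[leqRHS]tot; apply: leq_sum => i _; case: (_ && _).
have : (\sum_(i < N.+1) 1 <= \sum_(i < N.+1) ((a <= b + i <= a + N) +
  ((i < a) + (a + N < b + i))))%N.
  by apply: leq_sum => i _; lia.
rewrite tot !big_split /= lo hi; lia.
Qed.
End RootsOfUnity.

(** * Complex lines are closed *)

Section ComplexComplete.
Context {R : realType}.

Lemma real_cauchy (u : nat -> R) :
  (forall e : R, 0 < e -> exists N, forall m n, (N <= m)%N -> (N <= n)%N ->
    `|u m - u n| < e) ->
  exists l, forall e : R, 0 < e -> exists N, forall n, (N <= n)%N ->
    `|u n - l| < e.
Proof.
move=> uC; have /cvg_ex[l ul] : cvg (u @ \oo).
  apply/cauchy_cvgP; apply/cauchy_ballP => e /uC[N uN].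
  near_simpl; exists ([set n | N <= n], [set n | N <= n])%N; first by split;
    exists N.
  by move=> [m n] [/= Nm Nn]; exact: uN.
exists l => e e0; move/cvgrPdist_lt: ul => /(_ e e0)[N _ ulN]; exists N => n Nn.
by rewrite distrC; exact: ulN.
Qed.

Lemma complex_rcauchy (u : nat -> R[i]) : rcauchy u -> exists l, rcvg u l.
Proof.
move=> uC.
have [a ua] : exists l, forall e : R, 0 < e -> exists N, forall n, (N <= n)%N ->
    `|complex.Re (u n) - l| < e.
  apply: real_cauchy => e /uC[N uN]; exists N => m n Nm Nn.
  have [le _ _] := rnorm_ReIm (u m - u n); apply: le_lt_trans _ (uN m n Nm Nn).
  by apply: le_trans le; case: (u m) => ? ?; case: (u n).
have [b ub] : exists l, forall e : R, 0 < e -> exists N, forall n, (N <= n)%N ->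
    `|complex.Im (u n) - l| < e.
  apply: real_cauchy => e /uC[N uN]; exists N => m n Nm Nn.
  have [_ le _] := rnorm_ReIm (u m - u n); apply: le_lt_trans _ (uN m n Nm Nn).
  by apply: le_trans le; case: (u m) => ? ?; case: (u n).
exists (Complex a b) => e e0; have e20 : 0 < e / 2 by lra.
have [[N uN] [N' uN']] := (ua _ e20, ub _ e20).
exists (maxn N N') => n; rewrite geq_max => /andP[/uN h /uN' h'].
have [_ _] := rnorm_ReIm (u n - Complex a b).
by move: h h'; case: (u n) => c d /=; lra.
Qed.

(** If c_n q tends to x with q nonzero, then (c_n) is a Cauchy sequence of
    complex numbers. *)
Lemma line_closed (V : normedModType R[i]) (x q : V) :
  (forall e : R, 0 < e -> exists c, rnorm (x - c *: q) < e) ->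
    exists c, x = c *: q.
Proof.
move=> xq; have [q0|q0] := eqVneq q 0.
  exists 0; rewrite scale0r; apply: rnorm_small => e /xq[c].
  by rewrite q0 scaler0 subr0.
have nq : 0 < rnorm q.
  by rewrite lt_neqAle rnorm_ge0 andbT eq_sym;
    apply: contraNneq q0 => /rnorm_eq0 ->.
have /choice[c cP] n : exists c, rnorm (x - c *: q) < n.+1%:R^-1.
  by apply: xq; rewrite invr_gt0.
have small (e : R) : 0 < e -> exists N, forall n, (N <= n)%N ->
  rnorm (x - c n *: q) < e.
  move=> e0; exists (Num.truncn e^-1) => n Nn; apply: lt_le_trans (cP n) _.
  rewrite invf_ple ?posrE //; apply: le_trans (ltW (truncnS_gt _)) _.
  by rewrite ler_nat ltnS.
have [l cl] : exists l, rcvg c l.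
  apply: complex_rcauchy => e e0.
  have eq0 : 0 < e * rnorm q / 2 by apply: divr_gt0 => //; exact: mulr_gt0.
  have [N cN] := small _ eq0; exists N => m n /cN hm /cN hn.
  rewrite -(ltr_pM2r nq) -rnormZ scalerBl.
  have := rdistD x (c m *: q) (c n *: q); rewrite (rdistC (c m *: q) x); lra.
exists l; apply/eqP; rewrite -subr_eq0; apply/eqP/rnorm_small => e e0.
have e20 : 0 < e / 2 by lra.
have [N cN] := small _ e20; have [N' cN'] := cl _ (divr_gt0 e20 nq).
pose n := maxn N N'; have hn := cN n (leq_maxl _ _).
have := cN' n (leq_maxr _ _); rewrite ltr_pdivlMr // -rnormZ scalerBl.
have := rdistD (c n *: q) x (l *: q); lra.
Qed.
End ComplexComplete.

(** * Linear spans *)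

Section Span.
Context {R : realType} {A : lmodType R[i]}.
Implicit Types S P : set A.

Definition subspace (S : set A) :=
  S 0 /\ forall (a : R[i]) x y, S x -> S y -> S (a *: x + y).

Definition span (S : set A) : set A := smallest subspace S.

Lemma span_ind (S P : set A) : subspace P -> S `<=` P -> span S `<=` P.
Proof. by move=> Pl SP x; apply. Qed.

Lemma sub_span (S : set A) : S `<=` span S.
Proof. by move=> x Sx P [_]; apply. Qed.

Lemma span_subspace (S : set A) : subspace (span S).
Proof.
split=> [P [[]] //|a x y Sx Sy P PS]; have [[_ Pl] _] := PS.
by apply: Pl; [exact: Sx|exact: Sy].
Qed.

Lemma subspace_sum (S : set A) I (r : seq I) (P : pred I) (F : I -> A) :
  subspace S -> (forall i, P i -> S (F i)) -> S (\sum_(i <- r | P i) F i).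
Proof.
move=> [S0 Sl] SF; elim/big_ind: _ => // x y Sx Sy.
by rewrite -[x]scale1r; exact: Sl.
Qed.

Lemma subspaceZ (S : set A) a x : subspace S -> S x -> S (a *: x).
Proof. by move=> [S0 Sl] Sx; rewrite -[_ *: _]addr0; exact: Sl. Qed.
End Span.

(** * Generators, unit and monomials *)

Section CuntzKrieger.
Context {R : realType} {G : finDigraph} {A : cstarAlgType R}.
Variables (p : vertex G -> A) (t : edge G -> A).
Hypothesis hA : is_CK p t.

Let ckR : ck_family p t := ck_relations hA.

Lemma adj_p v : adj (p v) = p v. Proof. exact: ck_adj ckR v. Qed.
Lemma p_p v : p v ** p v = p v. Proof. exact: ck_idem ckR v. Qed.
Lemma p_t e : p (source e) ** t e = t e. Proof. exact: ck_source ckR e. Qed.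
Lemma t_p e : t e ** p (range_of e) = t e. Proof. exact: ck_range ckR e. Qed.
Lemma adjt_t e f : adj (t e) ** t f = if e == f then p (range_of e) else 0.
Proof. exact: ck_edge ckR e f. Qed.

Lemma p_p_neq v w : v != w -> p v ** p w = 0.
Proof. by move=> /eqP; exact: (ck_orth ckR). Qed.

Lemma p_t_neq v e : v != source e -> p v ** t e = 0.
Proof. by move=> /p_p_neq vs; rewrite -p_t cstar_mulA vs mul0c. Qed.

(** The elements satisfying S form a C*-subalgebra that contains the
    generators, hence all of A; the topological closure is phrased with
    distances. *)
Lemma CK_ind (S : set A) :
    S 0 -> (forall a x y, S x -> S y -> S (a *: x + y)) ->
    (forall x y, S x -> S y -> S (x ** y)) -> (forall x, S x -> S (adj x)) ->
    (forall x, (forall e : R, 0 < e -> exists2 y, S y & rnorm (x - y) < e) ->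
      S x) ->
    (forall v, S (p v)) -> (forall e, S (t e)) ->
  forall x, S x.
Proof.
move=> S0 SD SM SJ Scl Sp St x.
have : [set: A] x by [].
rewrite -(ck_generated hA); apply: smallest_sub;
  last by move=> _ [[v _ <-]|[e _ <-]].
by split=> // y /closure_rnorm; exact: Scl.
Qed.

Definition one : A := \sum_v p v.

Lemma one_p v : one ** p v = p v.
Proof.
by rewrite mulc_suml (bigD1 v) //= p_p big1 ?addr0 // => w /p_p_neq.
Qed.

Lemma p_one v : p v ** one = p v.
Proof.
by rewrite mulc_sumr (bigD1 v) //= p_p big1 ?addr0 // => w;
  rewrite eq_sym => /p_p_neq.
Qed.

(** The elements for which this holds form a C*-subalgebra; on t e, only the
    projections of its source and of its range matter. *)
Lemma one_unit : is_unit one.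
Proof.
have oneS : adj one = one by rewrite adj_sum; apply: eq_bigr => v _;
  exact: adj_p.
move=> x; apply: (@CK_ind [set x | one ** x = x /\ x ** one = x]) x => /=.
- by rewrite mul0c mulc0.
- move=> a x y [x1 x2] [y1 y2].
  by rewrite cstar_mulDr cstar_mulDl cstar_mulZr cstar_mulZl x1 x2 y1 y2.
- by move=> x y [x1 x2] [y1 y2]; split; [rewrite cstar_mulA x1|rewrite
    -cstar_mulA y2].
- by move=> x [x1 x2]; split; rewrite -{1}oneS -cstar_adjM ?x1 ?x2.
- move=> x xcl; have n1 : 0 <= rnorm one := rnorm_ge0 _.
  split; apply/eqP; rewrite -subr_eq0; apply/eqP/rnorm_small => e e0.
    have [|y [y1 _] xy] := xcl (e / (rnorm one + 1));
      first by apply: divr_gt0; lra.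
    have -> : one ** x - x = one ** (x - y) + (y - x).
      by rewrite mulcBr y1 addrA subrK.
    apply: le_lt_trans (rnormD _ _) _; rewrite (rdistC y).
    move: xy; rewrite ltr_pdivlMr; last by lra.
    have := rnormM one (x - y); lra.
  have [|y [_ y1] xy] := xcl (e / (rnorm one + 1)); first by apply: divr_gt0;
    lra.
  have -> : x ** one - x = (x - y) ** one + (y - x).
    by rewrite mulcBl y1 addrA subrK.
  apply: le_lt_trans (rnormD _ _) _; rewrite (rdistC y).
  move: xy; rewrite ltr_pdivlMr; last by lra.
  have := rnormM (x - y) one; lra.
- by move=> v; rewrite one_p p_one.
- by move=> e; rewrite -{1}(p_t e) -{3}(t_p e) -cstar_mulA p_one cstar_mulA
    one_p p_t t_p.
Qed.

Lemma mul1c x : one ** x = x. Proof. exact: (one_unit x).1. Qed.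
Lemma mulc1 x : x ** one = x. Proof. exact: (one_unit x).2. Qed.
Lemma adj1 : adj one = one. Proof. exact: unit_adj one_unit. Qed.

Definition central (z : A) := forall x, z ** x = x ** z.

Lemma central_gen z : (forall v, z ** p v = p v ** z) ->
  (forall e, z ** t e = t e ** z) ->
  (forall e, z ** adj (t e) = adj (t e) ** z) -> central z.
Proof.
move=> zp zt zt' x.
suff [] : z ** x = x ** z /\ z ** adj x = adj x ** z by [].
apply: (@CK_ind [set x | z ** x = x ** z /\ z ** adj x = adj x ** z]) x => /=.
- by rewrite adj0 mul0c mulc0.
- move=> a x y [x1 x2] [y1 y2]; rewrite cstar_adjD cstar_adjZ.
  by rewrite !cstar_mulDr !cstar_mulDl !cstar_mulZr !cstar_mulZl x1 x2 y1 y2.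
- move=> x y [x1 x2] [y1 y2]; rewrite cstar_adjM.
  by rewrite !cstar_mulA x1 y2 -!cstar_mulA y1 x2.
- by move=> x [x1 x2]; rewrite cstar_adjK.
- move=> x xcl.
  have comm_lim y : (forall e : R, 0 < e -> exists2 u,
    z ** u = u ** z & rnorm (y - u) < e) ->
      z ** y = y ** z.
    move=> ycl; apply/eqP; rewrite -subr_eq0; apply/eqP/rnorm_small => e e0.
    have n1 : 0 <= rnorm z := rnorm_ge0 _.
    have [|u zu yu] := ycl (e / (rnorm z + rnorm z + 1)).
      by apply: divr_gt0; lra.
    have -> : z ** y - y ** z = z ** (y - u) - (y - u) ** z.
      by rewrite mulcBr mulcBl zu opprB addrA subrK.
    apply: le_lt_trans (rnormD _ _) _; rewrite rnormN.
    move: yu; rewrite ltr_pdivlMr; last by lra.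
    have := rnormM z (y - u); have := rnormM (y - u) z;
      have := rnorm_ge0 (y - u); nra.
  split; apply: comm_lim => e /xcl[y [y1 y2] xy]; first by exists y.
  by exists (adj y); rewrite // -adjB rnorm_adj.
- by move=> v; rewrite adj_p.
- by move=> e; split.
Qed.

Local Notation L := (leavitt p t).

Lemma leavitt_subalgebra : subalgebra L.
Proof.
split=> [S [[]] //|a x y Lx Ly S SL|x y Lx Ly S SL].
  by have [[_ Sl _] _] := SL; apply: Sl; [exact: Lx|exact: Ly].
by have [[_ _ Sm] _] := SL; apply: Sm; [exact: Lx|exact: Ly].
Qed.

Lemma leavitt_subspace : subspace L.
Proof. by have [L0 Ll _] := leavitt_subalgebra. Qed.

Lemma leavittM x y : L x -> L y -> L (x ** y).
Proof. by have [_ _ Lm] := leavitt_subalgebra; exact: Lm. Qed.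

Lemma leavitt_p v : L (p v).
Proof. by move=> S [_]; apply; left; left; exists v. Qed.

Lemma leavitt_t e : L (t e).
Proof. by move=> S [_]; apply; left; right; exists e. Qed.

Lemma leavitt_adjt e : L (adj (t e)).
Proof. by move=> S [_]; apply; right; exists e. Qed.

Lemma leavitt_adj x : L x -> L (adj x).
Proof.
move: x; have sub (S : set A) : subalgebra S ->
    range p `|` range t `|` range (fun e => adj (t e)) `<=` S -> L `<=` S.
  by move=> Sa Sg x; apply.
apply: sub; last first.
  move=> _ [[[v _ <-]|[e _ <-]]|[e _ <-]] /=; rewrite ?adj_p ?cstar_adjK.
  - exact: leavitt_p.
  - exact: leavitt_adjt.
  - exact: leavitt_t.
have [L0 Ll Lm] := leavitt_subalgebra; split=> /=.
- by rewrite adj0.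
- by move=> a x y; rewrite cstar_adjD cstar_adjZ; exact: Ll.
- by move=> x y Lx Ly; rewrite cstar_adjM; exact: Lm.
Qed.

(** The limits of elements of L form a C*-subalgebra, as L is a subalgebra
    stable under adj. *)
Lemma leavitt_dense x (e : R) : 0 < e -> exists2 y, L y & rnorm (x - y) < e.
Proof.
move: e; apply: (@CK_ind [set x | forall e : R, 0 < e ->
  exists2 y, L y & rnorm (x - y) < e]) x => /=.
- by move=> e e0; exists 0; [exact: leavitt_subspace.1|rewrite subrr rnorm0].
- move=> a x y xL yL e e0; have a0 := rnorm_ge0 a.
  have [|x' Lx' xx'] := xL (e / (rnorm a + 1)); first by apply: divr_gt0; lra.
  have [|y' Ly' yy'] := yL (e / (rnorm a + 1)); first by apply: divr_gt0; lra.
  exists (a *: x' + y'); first exact: leavitt_subspace.2.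
  rewrite opprD addrACA -scalerBr; apply: le_lt_trans (rnormD _ _) _.
  move: xx' yy'; rewrite rnormZ !ltr_pdivlMr; [|lra..].
  have := rnorm_ge0 (y - y'); have := rnorm_ge0 (x - x'); nra.
- move=> x y xL yL e e0; have y0 := rnorm_ge0 y.
  have [|x' Lx' xx'] := xL (e / 2 / (rnorm y + 1)).
    by apply: divr_gt0; lra.
  have x0' := rnorm_ge0 x'.
  have [|y' Ly' yy'] := yL (e / 2 / (rnorm x' + 1)).
    by apply: divr_gt0; lra.
  exists (x' ** y'); first exact: leavittM.
  have -> : x ** y - x' ** y' = (x - x') ** y + x' ** (y - y').
    by rewrite mulcBl mulcBr addrA subrK.
  apply: le_lt_trans (rnormD _ _) _.
  move: xx' yy'; rewrite !ltr_pdivlMr; [|lra..].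
  have := rnormM (x - x') y; have := rnormM x' (y - y').
  have := rnorm_ge0 (y - y'); have := rnorm_ge0 (x - x'); nra.
- move=> x xL e /xL[y Ly xy]; exists (adj y); first exact: leavitt_adj.
  by rewrite -adjB rnorm_adj.
- move=> x xL e e0; have e20 : 0 < e / 2 by lra.
  have [y yL xy] := xL _ e20; have [z Lz yz] := yL _ e20.
  by exists z => //; have := rdistD y x z; lra.
- by move=> v e e0; exists (p v); [exact: leavitt_p|rewrite subrr rnorm0].
- by move=> f e e0; exists (t f); [exact: leavitt_t|rewrite subrr rnorm0].
Qed.

(** The edges of a word need not be composable: the product vanishes when they
    are not. *)
Definition word (al : seq (edge G)) : A := foldr (fun e x => t e ** x) one al.

Definition mono al v be : A := word al ** p v ** adj (word be).

Lemma word_rcons al e : word (rcons al e) = word al ** t e.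
Proof.
elim: al => [|f al IH]; rewrite /= ?mul1c ?mulc1 //.
by rewrite IH cstar_mulA.
Qed.

Lemma leavitt_word al : L (word al).
Proof.
elim: al => [|e al IH]; last exact: leavittM (leavitt_t e) IH.
by apply: subspace_sum leavitt_subspace _ => v _; exact: leavitt_p.
Qed.

(** Sets of admissible degrees are given by a relation between the lengths of
    the two words of a monomial: the degree is their difference, and the
    lengths themselves also matter below. *)
Definition mspan (D : nat -> nat -> Prop) : set A :=
  span [set x | exists al v be, D (size al) (size be) /\ x = mono al v be].

Lemma mspan_mono (D : nat -> nat -> Prop) al v be :
  D (size al) (size be) -> mspan D (mono al v be).
Proof. by move=> Dab; apply: sub_span; exists al, v, be. Qed.

Lemma mspan_ind (D : nat -> nat -> Prop) (P : set A) : subspace P ->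
  (forall al v be, D (size al) (size be) -> P (mono al v be)) -> mspan D `<=` P.
Proof. by move=> Pl PD; apply: span_ind => // _ [al [v [be [Dab ->]]]];
  exact: PD. Qed.

Lemma p_word v e al : p v ** word (e :: al) =
  if v == source e then word (e :: al) else 0.
Proof.
rewrite /= cstar_mulA; have [->|/p_t_neq ->] := eqVneq v (source e);
  first by rewrite p_t.
by rewrite mul0c.
Qed.

Lemma p_mono w al v be : p w ** mono al v be = mono al v be \/
  p w ** mono al v be = 0.
Proof.
rewrite /mono !cstar_mulA; case: al => [|e al].
  rewrite /= mulc1 mul1c; have [->|/p_p_neq ->] := eqVneq w v; first by left;
    rewrite p_p.
  by right; rewrite mul0c.
by rewrite p_word; case: eqP => _; [left|right; rewrite !mul0c].
Qed.

(** The span M of all monomials contains the unit and is stable under left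
    multiplication by the generators, hence by L, so x = x 1 lies in M for x in
    L. In this way no general product of two monomials has to be computed. *)
Lemma leavitt_mspan : L `<=` mspan (fun _ _ => True).
Proof.
set M := mspan _; have [M0 Ml] : subspace M := span_subspace _.
have gen x : (forall al v be, M (x ** mono al v be)) -> forall y, M y ->
  M (x ** y).
  move=> xM; apply: mspan_ind; last by move=> al v be _; exact: xM.
  split=> /= [|a y z My Mz]; first by rewrite mulc0.
  by rewrite cstar_mulDr cstar_mulZr; exact: Ml.
have genp w : forall y, M y -> M (p w ** y).
  apply: gen => al v be; have [->|->] := p_mono w al v be => //;
    exact: mspan_mono.
have Q x : L x -> forall y, M y -> M (x ** y).
  suff /(_ x) : L `<=` [set x | forall y, M y -> M (x ** y)] by [].
  move=> {}x; apply; split; first split=> /=.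
  - by move=> y; rewrite mul0c.
  - by move=> a u v Mu Mv y My; rewrite cstar_mulDl cstar_mulZl; apply: Ml;
      auto.
  - by move=> u v Mu Mv y My; rewrite -cstar_mulA; auto.
  move=> _ [[[v _ <-]|[e _ <-]]|[e _ <-]] //=; first exact: genp.
    apply: gen => al v be; rewrite /mono !cstar_mulA.
    exact: (@mspan_mono _ (e :: al) v be).
  apply: gen => -[|f al] v be; rewrite /mono !cstar_mulA /=.
    rewrite mulc1; have [->|vs] := eqVneq v (source e); last first.
      by rewrite -(cstar_adjK (p v)) -cstar_adjM adj_p p_t_neq // adj0 mul0c.
    rewrite -(adj_p (source e)) -cstar_adjM p_t -cstar_adjM -word_rcons.
    have -> : adj (word (rcons be e)) = mono [::] (range_of e) (rcons be e).
      rewrite /mono /= mul1c -(adj_p (range_of e)) -cstar_adjM word_rcons.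
      by rewrite -cstar_mulA t_p.
    exact: mspan_mono.
  rewrite adjt_t; case: eqP => _; last by rewrite !mul0c.
  have := genp (range_of e) _ (@mspan_mono _ al v be I);
    rewrite /mono !cstar_mulA.
  by apply.
move=> x Lx; rewrite -[x]mulc1; apply: Q => //.
apply: subspace_sum (span_subspace _) _ => v _.
have <- : mono [::] v [::] = p v by rewrite /mono /= adj1 mul1c mulc1.
exact: (@mspan_mono (fun _ _ => True) [::] v [::] I).
Qed.

(** * The gauge action and the homogeneous components *)

(** The family (p, l t) satisfies the same relations when |l| = 1. *)
Lemma gauge_exists (l : R[i]) : l * l^* = 1 ->
  exists f : A -> A, [/\ star_hom f, (forall v, f (p v) = p v) &
    forall e, f (t e) = l *: t e].
Proof.
move=> l1; apply: (ck_universal hA); split.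
- exact: adj_p.
- exact: p_p.
- by move=> v w /eqP; exact: p_p_neq.
- by move=> e; rewrite cstar_mulZr p_t.
- by move=> e; rewrite cstar_mulZl t_p.
- move=> e f; rewrite cstar_adjZ cstar_mulZl cstar_mulZr scalerA mulrC l1.
  by rewrite scale1r adjt_t.
- move=> v /(ck_sum ckR) {1}->; apply: eq_bigr => e _.
  by rewrite cstar_adjZ cstar_mulZl cstar_mulZr scalerA l1 scale1r.
Qed.

Lemma central_subspace : subspace central.
Proof.
split=> [x|a x y xC yC z]; first by rewrite mul0c mulc0.
by rewrite cstar_mulDl cstar_mulDr cstar_mulZl cstar_mulZr xC yC.
Qed.

(** A total form, so that an automorphism can be chosen for every scalar. *)
Lemma gauge_total l : exists f : A -> A, l * l^* = 1 ->
  [/\ star_hom f, (forall v, f (p v) = p v) & forall e, f (t e) = l *: t e].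
Proof.
have [/gauge_exists[f fP]|l1] := pselect (l * l^* = 1); first by exists f.
by exists id => /l1.
Qed.

Definition gauge_aut (l : R[i]) : A -> A := projT1 (cid (gauge_total l)).

Lemma gauge_autP l : l * l^* = 1 -> [/\ star_hom (gauge_aut l),
  (forall v, gauge_aut l (p v) = p v) & forall e, gauge_aut l (t e) = l *: t e].
Proof. exact: projT2 (cid (gauge_total l)). Qed.

Section Gauge.
Variable l : R[i].
Hypothesis l1 : l * l^* = 1.

Lemma gauge_aut_lin (a : R[i]) x y :
  gauge_aut l (a *: x + y) = a *: gauge_aut l x + gauge_aut l y.
Proof. by have [[fl _ _] _ _] := gauge_autP l1; exact: fl. Qed.
Lemma gauge_autM x y : gauge_aut l (x ** y) = gauge_aut l x ** gauge_aut l y.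
Proof. by have [[_ fM _] _ _] := gauge_autP l1. Qed.
Lemma gauge_aut_adj x : gauge_aut l (adj x) = adj (gauge_aut l x).
Proof. by have [[_ _ fJ] _ _] := gauge_autP l1. Qed.
Lemma gauge_aut_p v : gauge_aut l (p v) = p v.
Proof. by have [_ fp _] := gauge_autP l1. Qed.
Lemma gauge_aut_t e : gauge_aut l (t e) = l *: t e.
Proof. by have [_ _ ft] := gauge_autP l1. Qed.

Lemma gauge_aut0 : gauge_aut l 0 = 0.
Proof. by have := gauge_aut_lin (-1) 0 0; rewrite scaler0 addr0 scaleN1r
  addNr. Qed.

Lemma gauge_autD x y : gauge_aut l (x + y) = gauge_aut l x + gauge_aut l y.
Proof. by have := gauge_aut_lin 1 x y; rewrite !scale1r. Qed.

Lemma gauge_aut1 : gauge_aut l one = one.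
Proof.
rewrite /one (big_morph _ gauge_autD gauge_aut0); apply: eq_bigr => v _;
  exact: gauge_aut_p.
Qed.

Lemma rnorm_gauge_aut x : rnorm (gauge_aut l x) <= rnorm x.
Proof.
have [fS _ _] := gauge_autP l1; apply: (star_hom_contractive _ fS one_unit).
by rewrite gauge_aut1; exact: one_unit.
Qed.

Lemma unit_scale0 (x : A) : l *: x = 0 -> x = 0.
Proof. by move=> lx; rewrite -[x]scale1r -l1 mulrC -scalerA lx scaler0. Qed.

(** f z commutes with f (t e) = l t e, hence with the generators. *)
Lemma gauge_aut_central z : central z -> central (gauge_aut l z).
Proof.
move=> zC; apply: central_gen => [v|e|e].
- by rewrite -(gauge_aut_p v) -!gauge_autM zC.
- apply/eqP; rewrite -subr_eq0; apply/eqP/unit_scale0.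
  by rewrite scalerBr -cstar_mulZr -(cstar_mulZl l (t e)) -gauge_aut_t
    -!gauge_autM zC subrr.
- apply: (can_inj (@cstar_adjK _ A)); rewrite !cstar_adjM !cstar_adjK
    -!gauge_aut_adj.
  apply/eqP; rewrite -subr_eq0; apply/eqP/unit_scale0.
  rewrite scalerBr -(cstar_mulZl l (t e)) -cstar_mulZr -gauge_aut_t
    -!gauge_autM.
  by rewrite -(cstar_adjK (t e)) -!cstar_adjM zC subrr.
Qed.

Lemma gauge_aut_word al : gauge_aut l (word al) = l ^+ size al *: word al.
Proof.
elim: al => [|e al IH]; first by rewrite gauge_aut1 scale1r.
by rewrite /= gauge_autM IH gauge_aut_t cstar_mulZl cstar_mulZr scalerA exprS.
Qed.

Lemma gauge_aut_mono al v be :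
  gauge_aut l (mono al v be) = (l ^+ size al * l^* ^+ size be) *: mono al v be.
Proof.
rewrite /mono !gauge_autM gauge_aut_adj !gauge_aut_word gauge_aut_p cstar_adjZ
  rmorphXn.
by rewrite !cstar_mulZl cstar_mulZr scalerA.
Qed.
End Gauge.

Definition proot (M : nat) : R[i] := projT1 (cid (@prim_root_exists R M)).

Lemma prootP M : M.+1.-primitive_root (proot M).
Proof. exact: projT2 (cid (@prim_root_exists R M)). Qed.

Lemma proot_unit M k : proot M ^+ k * (proot M ^+ k)^* = 1.
Proof. exact: unit_root_conj (prootP M). Qed.

(** The discrete Fourier coefficient over the roots of unity of order M + 1: it
    keeps the monomials whose degree is i - j modulo M + 1. Degrees are given
    as differences i - j, the form in which they occur in the Fejer kernel. *)
Definition component_mod M i j (x : A) : A := M.+1%:R^-1 *: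
  \sum_(k < M.+1) ((proot M ^+ k) ^+ j * (proot M ^+ k)^* ^+ i) *:
    gauge_aut (proot M ^+ k) x.

Lemma component_mod_lin M i j (a : R[i]) x y :
  component_mod M i j (a *: x + y) =
  a *: component_mod M i j x + component_mod M i j y.
Proof.
rewrite /component_mod scalerA mulrC -scalerA -scalerDr; congr (_ *: _).
rewrite scaler_sumr -big_split; apply: eq_bigr => k _ /=.
by rewrite gauge_aut_lin ?proot_unit // scalerDr !scalerA [(a * _)%R]mulrC.
Qed.

Lemma component_modB M i j x y :
  component_mod M i j (x - y) = component_mod M i j x - component_mod M i j y.
Proof. by rewrite addrC -scaleN1r component_mod_lin scaleN1r addrC. Qed.

Lemma rnorm_proot M k : rnorm (proot M ^+ k) = 1.
Proof.
have := proot_unit M k; rewrite -normCK normE => /eqP.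
by rewrite -rmorphXn /= -[1]/((1 : R)%:C%C) => /eqP[] /eqP;
  rewrite sqrp_eq1 ?rnorm_ge0 // => /eqP.
Qed.

Lemma rnorm_component_mod M i j x : rnorm (component_mod M i j x) <= rnorm x.
Proof.
rewrite /component_mod rnormZ rnorm_natV ler_pdivrMl //.
apply: le_trans (rnorm_sum _ _ _) _.
have -> : M.+1%:R * rnorm x = \sum_(k < M.+1) rnorm x.
  by rewrite sumr_const card_ord mulr_natl.
apply: ler_sum => k _; rewrite rnormZ rnormcM (rnormX _ j) (rnormX _ i)
  rnorm_conj !rnorm_proot.
by rewrite !expr1n !mul1r rnorm_gauge_aut // proot_unit.
Qed.

Lemma component_mod_central M i j z : central z ->
  central (component_mod M i j z).
Proof.
move=> zC; apply: subspaceZ central_subspace _.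
apply: subspace_sum central_subspace _ => k _;
  apply: subspaceZ central_subspace _.
exact: gauge_aut_central (proot_unit M k) _ zC.
Qed.

Lemma component_mod_mono M i j al v be : component_mod M i j (mono al v be) =
  if (size al + j == size be + i %[mod M.+1])%N then mono al v be else 0.
Proof.
rewrite /component_mod.
under eq_bigr => k _ do rewrite gauge_aut_mono ?proot_unit // scalerA mulrACA
  -!exprD
  ![(_ + size _)%N]addnC.
rewrite -scaler_suml sum_prim_root ?prootP //; case: ifP => _.
  by rewrite scalerA mulVf ?scale1r // pnatr_eq0.
by rewrite scale0r scaler0.
Qed.

(** For large M, a congruence modulo M + 1 between two fixed integers is an
    equality. *)
Lemma component_mod_stable x i j : mspan (fun _ _ => True) x ->
  exists2 y, mspan (fun a b => a + j = b + i)%N y &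
    exists M0, forall M, (M0 <= M)%N -> component_mod M i j x = y.
Proof.
have [h0 hl] := span_subspace [set x | exists al v be,
  (size al + j = size be + i)%N /\ x = mono al v be].
move: x; apply: mspan_ind; first split=> /=.
- exists 0 => //; exists 0 => M _.
  by have := component_modB M i j 0 0; rewrite !subrr.
- move=> a x x' [y hy [M0 yE]] [y' hy' [M0' yE']]; exists (a *: y + y');
    first exact: hl.
  exists (maxn M0 M0') => M; rewrite geq_max => /andP[/yE yM /yE' yM'].
  by rewrite component_mod_lin yM yM'.
move=> al v be _.
have mod_big M : (size al + j + (size be + i) <= M)%N ->
    (size al + j == size be + i %[mod M.+1])%N = (size al + j == size be + i)%N.
  by move=> big; rewrite !modn_small //; lia.
have [eq|neq] := eqVneq (size al + j)%N (size be + i)%N.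
  exists (mono al v be); first exact: mspan_mono.
  by exists (size al + j + (size be + i))%N => M /mod_big modE;
    rewrite component_mod_mono modE eq eqxx.
exists 0 => //; exists (size al + j + (size be + i))%N => M /mod_big modE.
by rewrite component_mod_mono modE (negbTE neq).
Qed.

(** On the dense set L the sequence is eventually constant, and the operators
    are uniformly bounded by 1. *)
Lemma component_mod_cvg i j x :
  exists y, rcvg (fun M => component_mod M i j x) y.
Proof.
apply: (@rcauchy_cvg R A) => e e0; have e20 : 0 < e / 2 by lra.
have [y Ly xy] := leavitt_dense x e20.
have [u _ [M0 uE]] := component_mod_stable i j (leavitt_mspan Ly).
exists M0 => m n /uE um /uE un.
have := rdistD u (component_mod m i j x) (component_mod n i j x).
rewrite -{1}um -un -!component_modB.
have := rnorm_component_mod m i j (x - y); have :=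
  rnorm_component_mod n i j (y - x).
by rewrite (rdistC y); lra.
Qed.

Definition component i j x : A := projT1 (cid (component_mod_cvg i j x)).

Lemma component_cvg i j x :
  rcvg (fun M => component_mod M i j x) (component i j x).
Proof. exact: projT2 (cid (component_mod_cvg i j x)). Qed.

Lemma central_lim (u : nat -> A) z : (forall n, central (u n)) -> rcvg u z ->
  central z.
Proof.
move=> uC uz x; apply/eqP; rewrite -subr_eq0; apply/eqP.
apply: (@rcvg_unique _ _ (fun n => u n ** x - x ** u n)); last first.
  by move=> e e0; exists 0 => n _; rewrite uC subrr subr0 rnorm0.
apply: (rcvg_dom (C := rnorm x + rnorm x)) uz => n.
have -> : u n ** x - x ** u n - (z ** x - x ** z) =
  (u n - z) ** x - x ** (u n - z).
  by rewrite mulcBl mulcBr !opprB addrACA [RHS]addrACA; congr (_ + _);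
    exact: addrC.
apply: le_trans (rnormD _ _) _; rewrite rnormN mulrDl.
by apply: lerD (rnormM _ _); rewrite mulrC rnormM.
Qed.

Lemma component_central i j z : central z -> central (component i j z).
Proof.
by move=> zC; apply: central_lim (component_cvg i j z) => M;
  exact: component_mod_central.
Qed.

Lemma component_hom i j x (e : R) : 0 < e ->
  exists2 y, mspan (fun a b => a + j = b + i)%N y &
    rnorm (component i j x - y) < e.
Proof.
move=> e0; have e20 : 0 < e / 2 by lra.
have [y Ly xy] := leavitt_dense x e20.
have [u hu [M0 uE]] := component_mod_stable i j (leavitt_mspan Ly).
have [M1 xM] := component_cvg i j x e20.
exists u => //; pose M := maxn M0 M1.
have := xM M (leq_maxr _ _); have := rdistD (component_mod M i j x) (component
  i j x) u.
rewrite -{2}(uE M (leq_maxl _ _)) -component_modB (rdistC (component i j x)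
  (component_mod _ _ _ _)).
by have := rnorm_component_mod M i j (x - y); lra.
Qed.

(** The Cesaro means: the sum over 0 <= i, j <= N of the components of degree i
    - j counts degree m with multiplicity N + 1 - |m|. *)
Definition fejer_mod N M x : A :=
  N.+1%:R^-1 *: \sum_(i < N.+1) \sum_(j < N.+1) component_mod M i j x.

Definition fejer N x : A :=
  N.+1%:R^-1 *: \sum_(i < N.+1) \sum_(j < N.+1) component i j x.

Lemma fejer_mod_lin N M (a : R[i]) x y :
  fejer_mod N M (a *: x + y) = a *: fejer_mod N M x + fejer_mod N M y.
Proof.
rewrite /fejer_mod scalerA mulrC -scalerA -scalerDr; congr (_ *: _).
rewrite scaler_sumr -big_split; apply: eq_bigr => i _ /=.
rewrite scaler_sumr -big_split; apply: eq_bigr => j _ /=.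
by rewrite component_mod_lin.
Qed.

Lemma fejer_modB N M x y :
  fejer_mod N M (x - y) = fejer_mod N M x - fejer_mod N M y.
Proof. by rewrite addrC -scaleN1r fejer_mod_lin scaleN1r addrC. Qed.

(** As an average of gauge automorphisms, this operator has the Fejer kernel K
    as its weight: K k = |D k|^2 >= 0, where D k is the sum of the powers of w
    k of exponents 0, ..., N. The sum of the weights is (N + 1) (M + 1) as soon
    as N <= M, so the normalized weights form a probability. *)
Lemma rnorm_fejer_mod N M x : (N <= M)%N -> rnorm (fejer_mod N M x) <= rnorm x.
Proof.
move=> NM; pose w k := proot M ^+ k.
pose K k : R[i] := \sum_(i < N.+1) \sum_(j < N.+1) w k ^+ j * (w k)^* ^+ i.
have K_ge0 k : 0 <= K k.
  have -> : K k = (\sum_(j < N.+1) w k ^+ j) * (\sum_(j < N.+1) w k ^+ j)^*.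
    rewrite mulrC rmorph_sum mulr_suml; apply: eq_bigr => i _.
    by rewrite mulr_sumr; apply: eq_bigr => j _; rewrite [RHS]mulrC;
      congr (_ * _); apply/esym; exact: rmorphXn.
  exact: mul_conjC_ge0.
have sumK : \sum_(k < M.+1) K k = (N.+1 * M.+1)%:R.
  rewrite exchange_big /=; under eq_bigr => i _.
    rewrite exchange_big /=.
    under eq_bigr => j _ do rewrite sum_prim_root ?prootP //.
    rewrite (bigD1 i) //= eqxx big1 ?addr0; last first.
      move=> j ji; rewrite !modn_small ?ifN //.
      - exact: leq_trans (ltn_ord i) _.
      - exact: leq_trans (ltn_ord j) _.
    over.
  by rewrite /= sumr_const card_ord -[LHS]mulr_natl natrM.
have -> : fejer_mod N M x = N.+1%:R^-1 *: (M.+1%:R^-1 *: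
    \sum_(k < M.+1) K k *: gauge_aut (w k) x).
  congr (_ *: _); rewrite /component_mod.
  under eq_bigr do rewrite -scaler_sumr; rewrite -scaler_sumr; congr (_ *: _).
  under eq_bigr do rewrite exchange_big; rewrite exchange_big /=.
  apply: eq_bigr => k _; rewrite /K scaler_suml; apply: eq_bigr => i _.
  by rewrite scaler_suml.
rewrite !rnormZ !rnorm_natV mulrA -invfM -natrM mulnC ler_pdivrMl //.
apply: le_trans (rnorm_sum _ _ _) _.
have -> : (M.+1 * N.+1)%:R * rnorm x = \sum_(k < M.+1) rnorm (K k) * rnorm x.
  rewrite -mulr_suml; congr (_ * _); apply: complexI.
  rewrite rmorph_nat mulnC -sumK rmorph_sum; apply: eq_bigr => k _ /=.
  by rewrite -normE ger0_norm.
apply: ler_sum => k _; rewrite rnormZ; apply: ler_wpM2l (rnorm_ge0 _) _ _ _.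
by apply: rnorm_gauge_aut; exact: proot_unit.
Qed.

(** A monomial of degree m is multiplied by c / (N + 1), where c counts the
    pairs (i, j) with i - j = m; c differs from N + 1 by a bounded amount. *)
Lemma fejer_mod_approx x : mspan (fun _ _ => True) x ->
  exists C : R, forall N, exists M0, forall M, (M0 <= M)%N ->
    rnorm (fejer_mod N M x - x) <= C / N.+1%:R.
Proof.
move: x; apply: mspan_ind; first split=> /=.
- exists 0 => N; exists 0 => M _.
  by have := fejer_modB N M 0 0; rewrite !subrr => ->;
    rewrite subr0 rnorm0 mul0r.
- move=> a x y [C xC] [D yD]; exists (rnorm a * C + D) => N.
  have [[M0 xM] [M1 yM]] := (xC N, yD N); exists (maxn M0 M1) => M.
  rewrite geq_max => /andP[/xM {}xM /yM {}yM].
  rewrite fejer_mod_lin opprD addrACA -scalerBr; apply: le_trans (rnormD _ _) _.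
  rewrite rnormZ mulrDl -mulrA; apply: lerD yM.
  exact: ler_wpM2l (rnorm_ge0 _) _ _ xM.
move=> al v be _; exists ((size al + size be)%:R * rnorm (mono al v be)) => N.
exists (size al + size be + N)%N => M big.
have [cle cge] := sum_shift_diag N (size al) (size be).
pose c := (\sum_(i < N.+1) \sum_(j < N.+1) (size al + j == size be + i))%N.
have -> : fejer_mod N M (mono al v be) = (N.+1%:R^-1 * c%:R) *: mono al v be.
  rewrite /fejer_mod -scalerA; congr (_ *: _).
  rewrite natr_sum scaler_suml; apply: eq_bigr => i _.
  rewrite natr_sum scaler_suml; apply: eq_bigr => j _.
  rewrite component_mod_mono !modn_small; [|have := ltn_ord i;
    lia|have := ltn_ord j; lia].
  by case: ifP => _; rewrite ?scale1r ?scale0r.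
rewrite -[X in _ - X]scale1r -scalerBl rnormZ mulrAC.
apply: ler_wpM2r (rnorm_ge0 _) _ _ _.
have -> : (N.+1%:R^-1 * c%:R - 1 : R[i]) =
    (N.+1%:R^-1 * (c%:R - N.+1%:R) : R)%:C%C.
  rewrite mulrBr mulVf ?pnatr_eq0 // rmorphB rmorphM fmorphV !rmorph_nat
    rmorph1 //.
rewrite rnormC normrM ger0_norm ?invr_ge0 // mulrC.
apply: ler_wpM2r; first by rewrite invr_ge0.
rewrite ler0_norm ?opprB ?subr_le0 ?ler_nat // lerBlDl -natrD ler_nat.
exact: cge.
Qed.

Lemma fejer_cvg N x : rcvg (fun M => fejer_mod N M x) (fejer N x).
Proof.
have := @rcvg_sum R A _ (index_enum _) _ _ (fun i : 'I_N.+1 =>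
  @rcvg_sum R A _ (index_enum _) _ _ (fun j : 'I_N.+1 => @component_cvg i j x)).
apply: (rcvg_dom (C := N.+1%:R^-1)) => M.
by rewrite /fejer_mod /fejer -scalerBr rnormZ rnorm_natV.
Qed.

(** Uniform boundedness of the means reduces the claim to x in L. *)
Lemma fejer_approx x (e : R) : 0 < e -> exists N, rnorm (x - fejer N x) < e.
Proof.
move=> e0; have e40 : 0 < e / 4 by lra.
have [y Ly xy] := leavitt_dense x e40.
have [C yC] := fejer_mod_approx (leavitt_mspan Ly).
have [N CN] : exists N, C / N.+1%:R < e / 4.
  exists (Num.truncn (C / (e / 4))); rewrite ltr_pdivrMr // mulrC -ltr_pdivrMr
    //.
  exact: truncnS_gt.
have [M0 yM] := yC N; have [M1 xM] := fejer_cvg N x e40.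
exists N; pose M := maxn N (maxn M0 M1).
have NM : (N <= M)%N by rewrite leq_maxl.
have := rnorm_fejer_mod (x - y) NM; rewrite fejer_modB.
have := yM M; have := xM M; rewrite !leq_max !leqnn !orbT =>
  /(_ erefl) h1 /(_ erefl) h2 h3.
have := rdistD y x (fejer N x); have := rdistD (fejer_mod N M y) y (fejer N x).
have := rdistD (fejer_mod N M x) (fejer_mod N M y) (fejer N x).
rewrite (rdistC (fejer_mod N M y) (fejer_mod N M x)) (rdistC y (fejer_mod N M
  y)).
by move: CN h2; set c := C / _; lra.
Qed.

(** * Central homogeneous elements *)
Lemma mspan_sub (D D' : nat -> nat -> Prop) : (forall a b, D a b -> D' a b) ->
  mspan D `<=` mspan D'.
Proof.
move=> DD'; apply: mspan_ind; first exact: span_subspace.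
by move=> al v be /DD'; exact: mspan_mono.
Qed.

Lemma adj_mono al v be : adj (mono al v be) = mono be v al.
Proof. by rewrite /mono !cstar_adjM cstar_adjK adj_p cstar_mulA. Qed.

Lemma mspan_adj (D : nat -> nat -> Prop) x : mspan D x ->
  mspan (fun a b => D b a) (adj x).
Proof.
have [h0 hl] := span_subspace [set x | exists al v be,
  D (size be) (size al) /\ x = mono al v be].
move: x; apply: mspan_ind; first split=> /=; first by rewrite adj0.
  by move=> a x y hx hy; rewrite cstar_adjD cstar_adjZ; exact: hl.
by move=> al v be Dab; rewrite adj_mono; exact: mspan_mono.
Qed.

(** Combinations of monomials of degree n whose right word has length at most
    k; for k = 0 they are combinations of words of length n times vertex
    projections. *)
Definition homog n k : set A := mspan (fun a b => a = b + n /\ b <= k)%N.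

Lemma homog_subspace n k : subspace (homog n k).
Proof. exact: span_subspace. Qed.

Lemma homog_le n k k' : (k <= k')%N -> homog n k `<=` homog n k'.
Proof. by move=> kk'; apply: mspan_sub => a b [-> bk]; split=> //;
  exact: leq_trans kk'. Qed.

Lemma homog_bounded n x : mspan (fun a b => a = b + n)%N x ->
  exists k, homog n k x.
Proof.
move: x; apply: mspan_ind; first split=> /=.
- by exists 0; have [] := homog_subspace n 0.
- move=> a x y [k xk] [k' yk']; exists (maxn k k');
    apply: (homog_subspace _ _).2.
    exact: homog_le (leq_maxl _ _) _ xk.
  exact: homog_le (leq_maxr _ _) _ yk'.
by move=> al v be sz; exists (size be); apply: mspan_mono; split.
Qed.

Lemma homog_pl n k w x : homog n k x -> homog n k (p w ** x).
Proof.
have [h0 hl] := homog_subspace n k.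
move: x; apply: mspan_ind; first split=> /=; first by rewrite mulc0.
  by move=> a x y hx hy; rewrite cstar_mulDr cstar_mulZr; exact: hl.
move=> al v be Dab; have [->|->] := p_mono w al v be => //; exact: mspan_mono.
Qed.

Lemma mono_p al v be w : mono al v be ** p w = mono al v be \/
  mono al v be ** p w = 0.
Proof.
rewrite -[mono al v be]cstar_adjK adj_mono -(adj_p w) -cstar_adjM.
by have [->|->] := p_mono w be v al; [left|right; rewrite adj0].
Qed.

Lemma homog_pr n k w x : homog n k x -> homog n k (x ** p w).
Proof.
have [h0 hl] := homog_subspace n k.
move: x; apply: mspan_ind; first split=> /=; first by rewrite mul0c.
  by move=> a x y hx hy; rewrite cstar_mulDl cstar_mulZl; exact: hl.
move=> al v be Dab; have [->|->] := mono_p al v be w => //; exact: mspan_mono.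
Qed.

Lemma mono_nil v : mono [::] v [::] = p v.
Proof. by rewrite /mono /= adj1 mul1c mulc1. Qed.

Lemma mono_l al v : mono al v [::] = word al ** p v.
Proof. by rewrite /mono /= adj1 mulc1. Qed.

(** Compression by an edge either kills a monomial, or strips the first letters
    of both words, or, when the right word is already empty, rotates the left
    one. *)
Lemma homog_compress n k e x : homog n k x ->
  homog n k.-1 (adj (t e) ** x ** t e).
Proof.
have [h0 hl] := homog_subspace n k.-1.
move: x; apply: mspan_ind; first split=> /=; first by rewrite mulc0 mul0c.
  move=> a x y hx hy; rewrite cstar_mulDr cstar_mulZr cstar_mulDl cstar_mulZl.
  exact: hl.
move=> [|f al] v be /= [szab bk].
  have -> : be = [::] by apply: size0nil; lia.
  rewrite mono_nil; have [->|ve] := eqVneq v (source e); last first.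
    by rewrite -cstar_mulA p_t_neq // mulc0.
  rewrite -cstar_mulA p_t adjt_t eqxx -mono_nil; apply: mspan_mono => /=; lia.
case: be szab bk => [|g be] /= szab bk.
  rewrite mono_l /= !cstar_mulA adjt_t; case: eqP => _; last by rewrite !mul0c.
  have [->|ve] := eqVneq v (source e); last by rewrite -cstar_mulA p_t_neq //
    mulc0.
  rewrite -!cstar_mulA p_t -word_rcons.
  have -> : word (rcons al e) = mono (rcons al e) (range_of e) [::].
    by rewrite mono_l word_rcons -cstar_mulA t_p.
  by apply: homog_pl; apply: mspan_mono; rewrite size_rcons /=; lia.
rewrite /mono /= cstar_adjM !cstar_mulA adjt_t; case: eqP => _;
  last by rewrite !mul0c.
rewrite -cstar_mulA adjt_t; case: eqP => [->|_]; last by rewrite mulc0.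
apply: homog_pr; have : homog n k.-1 (mono al v be) by apply: mspan_mono; lia.
by move=> /(homog_pl (range_of e)); rewrite /mono !cstar_mulA.
Qed.

(** w is the range of a path of k edges. *)
Fixpoint reach k (w : vertex G) : Prop :=
  if k is k'.+1 then exists2 e, range_of e = w & reach k' (source e) else True.

Lemma reachS k w : reach k.+1 w -> reach k w.
Proof.
elim: k w => [//|k IH] w [e ew /IH re]; by exists e.
Qed.

Lemma reach_le k k' w : (k <= k')%N -> reach k' w -> reach k w.
Proof. by move=> /subnK <-; elim: (k' - k)%N => // d IH /reachS. Qed.

Lemma rnorm_p v : rnorm (p v) <= 1.
Proof.
by have := rnormE (p v); rewrite adj_p p_p; have := rnorm_ge0 (p v); nra.
Qed.

(** U is the product of the edges of a path of length k with range w, and p w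
    when k = 0. *)
Lemma reach_compress k w : reach k w -> exists U,
  [/\ adj U ** U = p w, U ** p w = U &
    forall n j x, homog n j x -> homog n (j - k) (adj U ** x ** U)].
Proof.
elim: k w => [|k IH] w /=.
  exists (p w); split=> [||n j x hx]; rewrite ?adj_p ?p_p // subn0.
  by apply: homog_pr; exact: homog_pl.
move=> [e <- /IH[U [UU Up Ux]]]; exists (U ** t e); rewrite cstar_adjM; split.
- by rewrite cstar_mulA -(cstar_mulA _ _ U) UU -cstar_mulA p_t adjt_t eqxx.
- by rewrite -cstar_mulA t_p.
move=> n j x /Ux/(homog_compress e); rewrite subnS !cstar_mulA.
by rewrite -(cstar_mulA (adj (t e))).
Qed.

Definition corner_approx n (z : A) w := forall e : R, 0 < e ->
  exists2 y, homog n 0 y & rnorm (z ** p w - y ** p w) < e.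

Definition hom_approx n (z : A) := forall e : R, 0 < e ->
  exists2 x, mspan (fun a b => a = b + n)%N x & rnorm (z - x) < e.

Lemma rnorm_compress (U x : A) : rnorm (adj U ** U) <= 1 ->
  rnorm (adj U ** x ** U) <= rnorm x.
Proof.
rewrite rnormE => U1; have U0 := rnorm_ge0 U; have x0 := rnorm_ge0 x.
have := rnormM (adj U ** x) U; have := rnormM (adj U) x; rewrite rnorm_adj.
have : rnorm U <= 1 by nra.
nra.
Qed.

(** As z is central, z p(w) = z (adj U) U = adj U z U; the length k of the path
    is chosen after the approximation x of z, so as to bring x down to words of
    length n. *)
Lemma reach_corner n z w : central z -> hom_approx n z ->
  (forall k, reach k w) -> corner_approx n z w.
Proof.
move=> zC zh rw e /zh[x /homog_bounded[k xk] zx].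
have [U [UU Up Ux]] := reach_compress (rw k).
exists (adj U ** x ** U); first by have := Ux _ _ _ xk; rewrite subnn.
rewrite -[adj U ** x ** U ** p w]cstar_mulA Up -UU cstar_mulA (zC (adj U)).
rewrite -mulcBl -mulcBr; apply: le_lt_trans zx.
by apply: rnorm_compress; rewrite UU rnorm_p.
Qed.

(** No word starts at a sink, so compressing by p(w) leaves only multiples of
    p(w) itself; they occur for n = 0. *)
Lemma sink_corner n z w : central z -> hom_approx n z ->
  (forall e, source e != w) -> corner_approx n z w.
Proof.
move=> zC zh sink e /zh[x hx zx]; exists (p w ** x ** p w).
  move: x hx {zx}; have [h0 hl] := homog_subspace n 0.
  apply: mspan_ind; first split=> /=; first by rewrite mulc0 mul0c.
    move=> a x y hx hy; rewrite cstar_mulDr cstar_mulZr cstar_mulDl cstar_mulZl.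
    exact: hl.
  move=> [|f al] v be /= szab.
    by apply: homog_pr; apply: homog_pl; apply: mspan_mono => /=; lia.
  by rewrite /mono /= !cstar_mulA p_t_neq 1?eq_sym // !mul0c.
rewrite -[_ ** p w ** p w]cstar_mulA p_p -[in z ** _](p_p w) cstar_mulA (zC (p
  w)).
rewrite -mulcBl -mulcBr; apply: le_lt_trans zx; rewrite -{1}adj_p.
by apply: rnorm_compress; rewrite adj_p p_p rnorm_p.
Qed.

Lemma word_iso al w : adj (word al) ** (word al ** p w) = p w \/
  word al ** p w = 0.
Proof.
elim: al => [|e al IH] /=; first by left; rewrite adj1 !mul1c.
rewrite cstar_adjM !cstar_mulA -(cstar_mulA (adj (word al))) adjt_t eqxx.
rewrite -(cstar_mulA _ _ (word al)) -cstar_mulA -(cstar_mulA (p _)).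
have := p_mono (range_of e) al w [::]; rewrite mono_l => -[re|re]; rewrite ?re.
  have [IHw|w0] := IH; first by left; rewrite IHw.
  by right; rewrite -cstar_mulA w0 mulc0.
by right; rewrite -(t_p e) -!cstar_mulA re mulc0.
Qed.

Lemma word_orth al be w : size al = size be -> al != be ->
  adj (word al) ** (word be ** p w) = 0.
Proof.
elim: al be => [|e al IH] [|f be] //= [sz]; rewrite eqseq_cons negb_and.
rewrite cstar_adjM !cstar_mulA -(cstar_mulA (adj (word al))) adjt_t.
case: eqP => [_|_] /=; last by rewrite mulc0 !mul0c.
move=> ab; rewrite -(cstar_mulA _ _ (word be)) -cstar_mulA -(cstar_mulA (p _)).
have := p_mono (range_of e) be w [::]; rewrite mono_l => -[->|->].
  exact: IH.
by rewrite mulc0.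
Qed.

(** The words T g of length n, times p(w), are partial isometries with
    orthogonal ranges, or zero. So an element y of their span is recovered from
    its coefficients adj (T g) y, which are multiples of p(w). Both facts are
    preserved under limits, and they place z p(w) in that span. *)
Lemma corner_leavitt n z w : corner_approx n z w -> L (z ** p w).
Proof.
move=> zw; set X := z ** p w.
pose T (g : n.-tuple (edge G)) := word g.
have corner y : homog n 0 y ->
    y ** p w = \sum_g T g ** (adj (T g) ** (y ** p w)) /\
    forall g, exists c : R[i], adj (T g) ** (y ** p w) = c *: p w.
  move: y; apply: mspan_ind; first split=> /=.
  - rewrite !mul0c; split=> [|g]; last by exists 0; rewrite mulc0 scale0r.
    by rewrite big1 // => g _; rewrite !mulc0.
  - move=> a x y [xS xc] [yS yc]; rewrite cstar_mulDl cstar_mulZl; split=> [|g].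
      rewrite {1}xS {1}yS scaler_sumr -big_split; apply: eq_bigr => g _ /=.
      by rewrite !cstar_mulDr !cstar_mulZr.
    have [[c xg] [d yg]] := (xc g, yc g); exists (a * c + d).
    by rewrite cstar_mulDr cstar_mulZr xg yg scalerDl scalerA.
  move=> al v be []; rewrite leqn0 => + /nilP be0; rewrite be0 /= => szal.
  rewrite mono_l -cstar_mulA.
  have [->|/p_p_neq vw] := eqVneq v w; last first.
    rewrite vw !mulc0; split=> [|g]; last by exists 0; rewrite mulc0 scale0r.
    by rewrite big1 // => g _; rewrite !mulc0.
  rewrite p_p; have {}szal : size al == n by apply/eqP; lia.
  split=> [|g].
    rewrite (bigD1 (Tuple szal)) //= big1 ?addr0.
      by rewrite /T /=; have [->|->] := word_iso al w; rewrite ?mulc0.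
    by move=> g gal; rewrite word_orth ?mulc0 // ?size_tuple ?(eqP szal) //.
  have [gal|gal] := @eqP _ (val g : seq _) al.
    rewrite /T gal; have [->|->] := word_iso al w; first by exists 1;
      rewrite scale1r.
    by exists 0; rewrite mulc0 scale0r.
  by exists 0; rewrite /T word_orth ?scale0r // ?size_tuple;
    [rewrite (eqP szal)|exact/eqP].
have XS : X = \sum_g T g ** (adj (T g) ** X).
  pose C := 1 + \sum_g rnorm (T g) * rnorm (T g).
  have C0 : 0 < C.
    by apply: ltr_wpDr => //; apply: sumr_ge0 => g _; apply: mulr_ge0;
      exact: rnorm_ge0.
  apply/eqP; rewrite -subr_eq0; apply/eqP/rnorm_small => e e0.
  have [y /corner[yS _] Xy] := zw _ (divr_gt0 e0 C0).
  have -> : X - \sum_g T g ** (adj (T g) ** X) =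
      (X - y ** p w) - \sum_g T g ** (adj (T g) ** (X - y ** p w)).
    under [in RHS]eq_bigr do rewrite !mulcBr.
    by rewrite sumrB -yS opprB addrA subrK.
  move: Xy; rewrite ltr_pdivlMr //; apply: le_lt_trans.
  apply: le_trans (rnormD _ _) _; rewrite rnormN mulrDr mulr1 lerD2l.
  apply: le_trans (rnorm_sum _ _ _) _; rewrite mulr_sumr; apply: ler_sum => g _.
  set d := X - _; have := rnormM (T g) (adj (T g) ** d);
    have := rnormM (adj (T g)) d.
  rewrite rnorm_adj; have := rnorm_ge0 (T g); nra.
have Xc g : exists c : R[i], adj (T g) ** X = c *: p w.
  have T0 : 0 < rnorm (T g) + 1 by have := rnorm_ge0 (T g); lra.
  apply: line_closed => e e0; have [y /corner[_ /(_ g)[c yc]] Xy] :=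
    zw _ (divr_gt0 e0 T0).
  exists c; rewrite -yc -mulcBr; move: Xy; rewrite ltr_pdivlMr //;
    apply: le_lt_trans.
  have := rnormM (adj (T g)) (X - y ** p w); rewrite rnorm_adj.
  have := rnorm_ge0 (X - y ** p w); nra.
rewrite XS; apply: subspace_sum leavitt_subspace _ => g _.
have [c ->] := Xc g; apply: leavittM (leavitt_word _) _.
exact: subspaceZ leavitt_subspace (leavitt_p _).
Qed.

(** A vertex v is bad when z p(v) is not in L. Every bad vertex has an edge to
    a bad vertex, so bad vertices are reached by paths of any length; but
    each of them is missed by the paths of some length k, as otherwise its
    corner would lie in L by approximation, and hence by all longer paths.
    There are finitely many vertices, so a single length is above all these k,
    a contradiction. *)
Lemma central_hom_leavitt n z : central z -> hom_approx n z -> L z.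
Proof.
move=> zC zh; suff zp v : L (z ** p v).
  rewrite -[z]mulc1 mulc_sumr; exact: subspace_sum leavitt_subspace _.
apply: contrapT => bad_v; pose bad v := ~ L (z ** p v).
have step w : bad w -> exists2 e, source e = w & bad (range_of e).
  move=> bw; apply: contrapT => no_e; apply: bw.
  have [e0|sink] := pselect (exists e, source e = w); last first.
    apply: (corner_leavitt (sink_corner zC zh _)) => e.
    by apply/eqP => ew; apply: sink; exists e.
  rewrite (ck_sum ckR e0) mulc_sumr; apply: subspace_sum leavitt_subspace _ =>
    e /eqP ew.
  have Lr : L (z ** p (range_of e)) by apply: contrapT => br; apply: no_e;
    exists e.
  have -> : z ** (t e ** adj (t e)) = t e ** (z ** p (range_of e)) ** adj (t e).
    by rewrite !cstar_mulA -(zC (t e)) -(cstar_mulA z _ (p _)) t_p.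
  exact: leavittM (leavittM (leavitt_t e) Lr) (leavitt_adjt e).
have bad_reach k : exists2 w, bad w & reach k w.
  elim: k => [|k [w bw rw]]; first by exists v.
  have [e ew be] := step w bw; exists (range_of e) => //.
  by exists e; rewrite ?ew.
have /choice[k kP] w : exists k, bad w -> ~ reach k w.
  apply: contrapT => all_reach.
  have bw : bad w by apply: contrapT => gw; apply: all_reach; exists 0 => /gw.
  apply: bw; apply: (corner_leavitt (reach_corner zC zh _)) => k.
  by apply: contrapT => nr; apply: all_reach; exists k.
have [w bw rw] := bad_reach (\sum_w k w)%N.
apply: (kP w bw); apply: reach_le rw.
by rewrite (bigD1 w) //= leq_addr.
Qed.

(** For j > i the degree is negative and the adjoint is used. *)
Lemma component_leavitt i j z : central z -> L (component i j z).
Proof.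
move=> zC; have PC := component_central i j zC.
have [ji|ij] := leqP j i.
  apply: (@central_hom_leavitt (i - j)) => // e /(component_hom i j z)[y hy Py].
  by exists y => //; apply: mspan_sub hy => a b; lia.
rewrite -[component i j z]cstar_adjK; apply: leavitt_adj.
apply: (@central_hom_leavitt (j - i)) => [x|e /(component_hom i j z)[y hy Py]].
  by rewrite -[x]cstar_adjK -!cstar_adjM PC.
exists (adj y); last by rewrite -adjB rnorm_adj.
by apply: mspan_sub (mspan_adj hy) => a b; lia.
Qed.

Lemma center_approx z (e : R) : central z -> 0 < e ->
  exists2 y, L y /\ central y & rnorm (z - y) < e.
Proof.
move=> zC /(fejer_approx z)[N zN]; exists (fejer N z) => //; split.
  apply: subspaceZ leavitt_subspace _; apply: subspace_sum leavitt_subspace _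
    => i _.
  by apply: subspace_sum leavitt_subspace _ => j _; exact: component_leavitt.
apply: subspaceZ central_subspace _; apply: subspace_sum central_subspace _ =>
  i _.
by apply: subspace_sum central_subspace _ => j _; exact: component_central.
Qed.

Lemma center_leavitt_central z : alg_center L z -> central z.
Proof.
move=> [_ zL]; apply: central_gen => [v|e|e]; apply: zL.
- exact: leavitt_p.
- exact: leavitt_t.
- exact: leavitt_adjt.
Qed.

End CuntzKrieger.

Theorem corollary1 (R : realType) (G : finDigraph) (A : cstarAlgType R)
    (p : vertex G -> A) (t : edge G -> A) (hA : is_CK p t) :
  alg_center [set: A]%classic = closure (alg_center (leavitt p t)).
Proof.
apply/seteqP; split=> z.
  move=> [_ zC]; apply/closure_rnorm => e e0.
  have [y [Ly yC] zy] := center_approx hA (fun x => zC x I) e0.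
  by exists y.
move=> /closure_rnorm zcl; split=> // x _.
have /choice[u uP] n : exists u, alg_center (leavitt p t) u /\ rnorm (z - u) <
  n.+1%:R^-1.
  by have [|u] := zcl n.+1%:R^-1; [rewrite invr_gt0|exists u].
suff uz : rcvg u z by apply: (central_lim _ uz) => n;
  exact: (center_leavitt_central hA (uP n).1).
move=> e e0; exists (Num.truncn e^-1) => n Nn; rewrite rdistC;
  apply: lt_le_trans (uP n).2 _.
rewrite invf_ple ?posrE //; apply: le_trans (ltW (truncnS_gt _)) _.
by rewrite ler_nat ltnS.
Qed.
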